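(* Let $\lambda\in P$, $\lhd\in\mathrm{RO}(\lambda,\Delta^+)$ and $w\in W$. The forgetful map $\tilde\Xi:\mathcal{A}(w,\Gamma)\to\mathrm{IQLS}(\lambda)\times W$, $A\mapsto(\Xi(A),\mathrm{end}(A))$, is injective.
   Context: Let $\mathfrak{g}$ be a finite-dimensional complex simple Lie algebra with root system $\Delta$, positive roots $\Delta^+$, Weyl group $W$ with length function $\ell$ and reflections $s_\alpha$, weight lattice $P$, pairing $\langle\cdot,\cdot\rangle$, $\alpha^\vee$ the coroot of $\alpha$, $\rho=\frac12\sum_{\alpha\in\Delta^+}\alpha$. For $\alpha\in\Delta$, $\operatorname{sgn}(\alpha)=\pm1$ according as $\alpha\in\pm\Delta^+$, and $|\alpha|=\operatorname{sgn}(\alpha)\alpha$. For $\lambda\in P$, $\Delta^+(\lambda)_{>0}$, $\Delta^+(\lambda)_{=0}$, $\Delta^+(\lambda)_{<0}$ are the sets of $\alpha\in\Delta^+$ with $\langle\lambda,\alpha^\vee\rangle>0$, $=0$, $<0$. Quantum Bruhat graph $\mathrm{QBG}(W)$: vertices $W$; an edge $x\xrightarrow{\alpha}y$ ($\alpha\in\Delta^+$) whenever $y=xs_\alpha$ and either $\ell(y)=\ell(x)+1$ (Bruhat edge) or $\ell(y)=\ell(x)-2\langle\rho,\alpha^\vee\rangle+1$ (quantum edge). Reflection orders: a total order $\lhd$ on $\Delta^+$ is a reflection order if whenever $\alpha,\beta,\alpha+\beta\in\Delta^+$, either $\alpha\lhd\alpha+\beta\lhd\beta$ or $\beta\lhd\alpha+\beta\lhd\alpha$;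 $\mathrm{RO}(\lambda,\Delta^+)$ is the set of those with $\alpha\lhd\beta\lhd\gamma$ for $\alpha\in\Delta^+(\lambda)_{<0}$, $\beta\in\Delta^+(\lambda)_{=0}$, $\gamma\in\Delta^+(\lambda)_{>0}$. Fix such $\lhd$. Interpolated QLS paths: for $x,y\in W$, $\sigma\in\mathbb{Q}$, write $x\overset{(\lambda,+)}{\Longrightarrow}_\sigma y$ if there is a directed path $x=x_0\xrightarrow{\gamma_1}x_1\to\cdots\xrightarrow{\gamma_r}x_r=y$ in $\mathrm{QBG}(W)$ ($r\ge0$) with all $\gamma_k\in\Delta^+(\lambda)_{>0}$, $\gamma_{k+1}\lhd\gamma_k$ for all $k$, and $\sigma\langle\lambda,\gamma_k^\vee\rangle\in\mathbb{Z}$ for all $k$; $x\overset{(\lambda,-)}{\Longrightarrow}_\sigma y$ is defined identically with $\Delta^+(\lambda)_{<0}$ in place of $\Delta^+(\lambda)_{>0}$. An interpolated QLS path of shape $\lambda$ is a triple $\eta=(x_1,\dots,x_s;y_1,\dots,y_{s-1};\sigma_0,\dots,\sigma_s)$ ($s\ge1$) with $x_i,y_i\in W$, $x_i\ne x_{i+1}$, $y_i\ne y_{i+1}$, $\sigma_i\in\mathbb{Q}$, $0=\sigma_0<\sigma_1<\dots<\sigma_s=1$, and for $1\le i\le s-1$: $x_{i+1}\overset{(\lambda,-)}{\Longrightarrow}_{\sigma_i}y_i$ and $y_i\overset{(\lambda,+)}{\Longrightarrow}_{\sigma_i}x_i$. $\mathrm{IQLS}(\lambda)$ is the set of these. Affine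 data: real affine coroots $\gamma^\vee+k\tilde\delta$ ($\gamma\in\Delta$, $k\in\mathbb{Z}$, $\tilde\delta$ formal); for $\beta^\vee=\gamma^\vee+k\tilde\delta$ put $\overline{\beta^\vee}=\gamma^\vee$, $\overline\beta=\gamma$, $\deg(\beta^\vee)=k$; it is positive if $k>0$ or ($k=0$, $\gamma\in\Delta^+$), negative otherwise; $t_\lambda(\gamma^\vee+k\tilde\delta)=\gamma^\vee+(k-\langle\lambda,\gamma^\vee\rangle)\tilde\delta$; $\mathrm{Inv}(\lambda)$ is the set of positive real affine coroots $\beta^\vee$ with $t_\lambda(\beta^\vee)$ negative (for these, $\langle\lambda,\overline{\beta^\vee}\rangle>0$ and $\overline\beta\in\Delta^+(\lambda)_{>0}\sqcup(-\Delta^+(\lambda)_{<0})$); put $d(\beta^\vee)=\deg(\beta^\vee)/\langle\lambda,\overline{\beta^\vee}\rangle$. Order $\prec$ on $\Delta^+(\lambda)_{>0}\sqcup(-\Delta^+(\lambda)_{<0})$: elements of $\Delta^+(\lambda)_{>0}$ precede those of $-\Delta^+(\lambda)_{<0}$; $\gamma\prec\gamma'$ iff $\gamma\lhd\gamma'$ on $\Delta^+(\lambda)_{>0}$; $-\alpha\prec-\alpha'$ iff $\alpha\lhd\alpha'$ on $-\Delta^+(\lambda)_{<0}$. Order $<$ on $\mathrm{Inv}(\lambda)$: $\beta^\vee<\beta'^\vee$ iff $d(\beta^\vee)<d(\beta'^\vee)$, or they are equal and $\overline{\beta'}\prec\overline\beta$. Write $\mathrm{Inv}(\lambda)=\{\beta_1^\vee<\dots<\beta_r^\vee\}$,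 $\gamma_k:=\overline{\beta_k}$, $d_k:=d(\beta_k^\vee)$, and $\Gamma:=(\gamma_1,\dots,\gamma_r)$ (the suitable $\lambda$-chain for $\lhd$). Admissible subsets: for $w\in W$, $\mathcal{A}(w,\Gamma)$ is the set of $A=\{j_1<\dots<j_p\}\subseteq\{1,\dots,r\}$ such that $w=u_0\xrightarrow{|\gamma_{j_1}|}u_1\to\cdots\xrightarrow{|\gamma_{j_p}|}u_p$ is a directed path in $\mathrm{QBG}(W)$, where $u_a:=ws_{|\gamma_{j_1}|}\cdots s_{|\gamma_{j_a}|}$; $\mathrm{end}(A):=u_p$. One has $0\le d_{j_1}\le\dots\le d_{j_p}\le1$. The map $\Xi$: let $0<c_1<\dots<c_{t-1}<1$ ($t\ge1$) be the distinct values among $d_{j_1},\dots,d_{j_p}$ lying strictly between $0$ and $1$; put $c_0:=0$, $c_t:=1$. For $1\le a\le t$ let $m_a:=\#\{b\mid d_{j_b}<c_a\}$; for $1\le a\le t-1$ let $n_a:=m_a+\#\{b\mid m_a<b\le m_{a+1},\ \gamma_{j_b}\in-\Delta^+\}$. Then $\Xi(A):=(x_1,\dots,x_t;y_1,\dots,y_{t-1};\sigma_0,\dots,\sigma_t)$ with $x_i:=u_{m_{t+1-i}}$, $y_i:=u_{n_{t-i}}$, $\sigma_i:=1-c_{t-i}$; this lies in $\mathrm{IQLS}(\lambda)$. *)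

(* Defs.v *)
From HB Require Import structures.
From mathcomp Require Import all_boot all_order all_algebra.
Set Implicit Arguments. Unset Strict Implicit. Unset Printing Implicit Defensive.
Import Order.TTheory GRing.Theory Num.Theory.
Local Open Scope ring_scope.

Section RootData.
Variables (R : realFieldType) (n : nat).
Notation V := 'cV[R]_n.
Notation Mat := 'M[R]_n.

Definition dot (u v : V) : R := (u^T *m v) 0 0.

Definition pairing (v a : V) : R := 2 * dot v a / dot a a.

Definition refl (a : V) : Mat := 1%:M - (2 / dot a a) *: (a *m a^T).

(* Delta is a reduced, irreducible, crystallographic root system spanning V,
   i.e. the root system of a finite-dimensional complex simple Lie algebra *)
Definition simple_root_system (D : seq V) : Prop :=
  [/\ D != [::], uniq D & (0 : V) \notin D] /\
  (forall v : V, (forall a, a \in D -> dot v a = 0) -> v = 0) /\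
  (forall a b, a \in D -> b \in D -> refl a *m b \in D) /\
  (forall a b, a \in D -> b \in D -> exists z : int, pairing b a = z%:~R) /\
  (forall a (c : R), a \in D -> c *: a \in D -> c = 1 \/ c = -1) /\
  (forall P : pred V,
     (forall a b, a \in D -> b \in D -> P a -> ~~ P b -> dot a b = 0) ->
     (forall a, a \in D -> P a) \/ (forall a, a \in D -> ~~ P a)).

Definition positive_system (D Dp : seq V) : Prop :=
  uniq Dp /\ exists f : V, (forall a, a \in D -> dot f a != 0) /\
    (forall a, (a \in Dp) = (a \in D) && (0 < dot f a)).

Definition inW (D : seq V) (w : Mat) : Prop :=
  exists s : seq V, all (mem D) s /\ w = foldr (fun a m => refl a *m m) 1%:M s.

Definition wlength (Dp : seq V) (w : Mat) : nat :=
  count (fun a => - (w *m a) \in Dp) Dp.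

Definition rho (Dp : seq V) : V := 2^-1 *: \sum_(a <- Dp) a.

Definition qbg_edge (Dp : seq V) (x : Mat) (a : V) (y : Mat) : Prop :=
  [/\ a \in Dp, y = x *m refl a &
      (wlength Dp y = (wlength Dp x).+1 \/
       (wlength Dp y)%:R = (wlength Dp x)%:R - 2 * pairing (rho Dp) a + 1)].

Definition in_weight_lattice (D : seq V) (lam : V) : Prop :=
  forall a, a \in D -> exists z : int, pairing lam a = z%:~R.

(* a total order on Dp is given by a listing ord of Dp; a <| b iff a comes
   before b in ord *)
Definition olt (ord : seq V) (a b : V) : bool := (index a ord < index b ord)%N.

Definition reflection_order (Dp ord : seq V) : Prop :=
  perm_eq ord Dp /\
  forall a b, a \in Dp -> b \in Dp -> a + b \in Dp ->
    (olt ord a (a + b) && olt ord (a + b) b) ||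
    (olt ord b (a + b) && olt ord (a + b) a).

Definition RO (lam : V) (Dp ord : seq V) : Prop :=
  reflection_order Dp ord /\
  forall a b, a \in Dp -> b \in Dp ->
    [/\ (pairing lam a < 0 -> pairing lam b = 0 -> olt ord a b),
        (pairing lam a = 0 -> 0 < pairing lam b -> olt ord a b) &
        (pairing lam a < 0 -> 0 < pairing lam b -> olt ord a b)].

(* real affine coroots gamma^vee + k delta are encoded as pairs (gamma, k);
   positivity of gamma^vee + k delta with k given as an element of R *)
Definition aff_pos (Dp : seq V) (g : V) (k : R) : Prop :=
  0 < k \/ (k = 0 /\ g \in Dp).

(* beta^vee = (g, k) lies in Inv(lambda) : positive with t_lambda(beta^vee)
   = g^vee + (k - <lambda, g^vee>) delta negative *)
Definition inInv (D Dp : seq V) (lam : V) (b : V * int) : Prop :=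
  [/\ b.1 \in D, aff_pos Dp b.1 b.2%:~R &
      ~ aff_pos Dp b.1 (b.2%:~R - pairing lam b.1)].

Definition dInv (lam : V) (b : V * int) : R := b.2%:~R / pairing lam b.1.

(* the order "prec" on Dp(lam)_{>0} \sqcup -Dp(lam)_{<0} *)
Definition aprec (Dp ord : seq V) (g g' : V) : bool :=
  [|| (g \in Dp) && (g' \notin Dp),
      [&& g \in Dp, g' \in Dp & olt ord g g'] |
      [&& g \notin Dp, g' \notin Dp & olt ord (- g) (- g')]].

Definition invlt (Dp ord : seq V) (lam : V) (b b' : V * int) : bool :=
  (dInv lam b < dInv lam b') ||
  ((dInv lam b == dInv lam b') && aprec Dp ord b'.1 b.1).

Definition is_lambda_chain (D Dp ord : seq V) (lam : V) (chain : seq (V * int))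
  : Prop :=
  [/\ forall b, b \in chain <-> inInv D Dp lam b, uniq chain &
      sorted (invlt Dp ord lam) chain].

Definition absr (Dp : seq V) (g : V) : V := if g \in Dp then g else - g.

(* Subsets A = {j_1 < ... < j_p} of the index set are encoded as strictly
   increasing lists of 0-based indices into chain. *)
Definition gam (chain : seq (V * int)) (j : nat) : V := (nth (0, 0%:Z) chain j).1.
Definition dd (lam : V) (chain : seq (V * int)) (j : nat) : R :=
  dInv lam (nth (0, 0%:Z) chain j).

Definition uA (Dp : seq V) (chain : seq (V * int)) (w : Mat) (A : seq nat)
  (a : nat) : Mat :=
  foldl (fun u j => u *m refl (absr Dp (gam chain j))) w (take a A).

Definition admissible (Dp : seq V) (chain : seq (V * int)) (w : Mat)
  (A : seq nat) : Prop :=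
  [/\ sorted ltn A, all (fun j => (j < size chain)%N) A &
      forall a, (a < size A)%N ->
        qbg_edge Dp (uA Dp chain w A a) (absr Dp (gam chain (nth 0 A a)))
                 (uA Dp chain w A a.+1)].

Definition endA (Dp : seq V) (chain : seq (V * int)) (w : Mat) (A : seq nat)
  : Mat := uA Dp chain w A (size A).

Definition Xi (Dp : seq V) (lam : V) (chain : seq (V * int)) (w : Mat)
  (A : seq nat) : seq Mat * seq Mat * seq R :=
  let ds := [seq dd lam chain j | j <- A] in
  let cs := sort <=%R (undup [seq c <- ds | (0 < c) && (c < 1)]) in
  let t := (size cs).+1 in
  let c := fun a => nth 0 (0 :: rcons cs 1) a in
  let m := fun a => count (fun x => x < c a) ds in
  let gs := [seq gam chain j | j <- A] in
  let nn := fun a => (m a + count (fun g => g \notin Dp)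
                                 (take (m a.+1 - m a) (drop (m a) gs)))%N in
  let u := uA Dp chain w A in
  ([seq u (m (t.+1 - i)%N) | i <- iota 1 t],
   [seq u (nn (t - i)%N) | i <- iota 1 t.-1],
   [seq 1 - c (t - i)%N | i <- iota 0 t.+1]).

End RootData.

(* Main.v *)
(** Up to bookkeeping, [Xi A] records the vertices at which the path of [A]
passes from one value of [d], or one sign of [gamma], to the next.  Between two
such vertices the labels decrease for the reflection order, so everything rests
on the uniqueness of a label-monotone path with given ends in the quantum Bruhat
graph (Brenti-Fomin-Postnikov).

That uniqueness is proved here by a deformation.  For [0 < t < 1] give every
step [u -> u s_b] a weight [wt u b] such that, after conjugation by [t ^ len u],
edges of the quantum Bruhat graph have weight at least [1 - t^2] and all other
steps have nonnegative weight; [Z L u v] sums the products of weights over all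
monotone sequences of steps from [u] to [v].  Left multiplication by a finite
simple reflection, or by the reflection in a highest root (twisted by a power of
[t]), commutes with [Z] as in a Hecke algebra.  For the normalized sum [Zn] this
gives [Zn (s u) (s v) = Zn u v] when [u] and [v] are both raised or both lowered
by [s], and writes [Zn u v] as a convex combination of [Zn (s u) (s v)] and
[Zn u (s v)] when [s] raises [u] and lowers [v].  A maximum principle yields
[Zn <= 1], whereas two monotone paths would give at least [2 (1 - t^2) ^ N],
which exceeds 1 for small [t]. *)
Require Import Defs.
From HB Require Import structures.
From mathcomp Require Import all_boot all_order all_algebra.
From mathcomp Require Import zify ring lra.
From Stdlib Require Import Classical.
Import Order.TTheory GRing.Theory Num.Theory.
Local Open Scope ring_scope.
Set Implicit Arguments. Unset Strict Implicit. Unset Printing Implicit Defensive.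

(** * Euclidean reflections *)

Section Euclid.
Variables (R : realFieldType) (n : nat).
Notation V := 'cV[R]_n.
Notation Mat := 'M[R]_n.
Implicit Types (u v x y a b : V) (A w : Mat) (c : R).

Lemma dotE u v : dot u v = \sum_i u i 0 * v i 0.
Proof. by rewrite /dot mxE; apply: eq_bigr => i _; rewrite mxE. Qed.

Lemma dotC u v : dot u v = dot v u.
Proof. by rewrite !dotE; apply: eq_bigr => i _; rewrite mulrC. Qed.

Lemma dotDr u v x : dot u (v + x) = dot u v + dot u x.
Proof. by rewrite /dot mulmxDr mxE. Qed.

Lemma dotZr u v c : dot u (c *: v) = c * dot u v.
Proof. by rewrite /dot -scalemxAr mxE. Qed.

Lemma dotNr u v : dot u (- v) = - dot u v.
Proof. by rewrite /dot mulmxN mxE. Qed.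

Lemma dot0r u : dot u 0 = 0.
Proof. by rewrite /dot mulmx0 mxE. Qed.

Lemma dotDl u v x : dot (u + v) x = dot u x + dot v x.
Proof. by rewrite dotC dotDr !(dotC x). Qed.

Lemma dotZl u v c : dot (c *: u) v = c * dot u v.
Proof. by rewrite dotC dotZr dotC. Qed.

Lemma dotNl u v : dot (- u) v = - dot u v.
Proof. by rewrite dotC dotNr dotC. Qed.

Lemma dotBr u v x : dot u (v - x) = dot u v - dot u x.
Proof. by rewrite dotDr dotNr. Qed.

Lemma dotBl u v x : dot (u - v) x = dot u x - dot v x.
Proof. by rewrite dotDl dotNl. Qed.

Lemma dot_suml (I : Type) (r : seq I) (F : I -> V) v :
  dot (\sum_(i <- r) F i) v = \sum_(i <- r) dot (F i) v.
Proof.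
elim/big_rec2: _ => [|i y1 y2 _ <-]; first by rewrite dotC dot0r.
by rewrite dotDl.
Qed.

Lemma dotM A u v : dot (A *m u) v = dot u (A^T *m v).
Proof. by rewrite /dot trmx_mul mulmxA. Qed.

Lemma dot_ge0 u : 0 <= dot u u.
Proof. by rewrite dotE sumr_ge0 // => i _; rewrite -expr2 sqr_ge0. Qed.

Lemma dot_eq0 u : (dot u u == 0) = (u == 0).
Proof.
apply/idP/eqP => [|->]; last by rewrite dot0r.
rewrite dotE psumr_eq0; last by move=> i _; rewrite -expr2 sqr_ge0.
move=> /allP h; apply/colP => i; rewrite mxE.
have := h i (mem_index_enum i).
by rewrite -expr2 sqrf_eq0 => /eqP.
Qed.

Lemma dot_gt0 u : u != 0 -> 0 < dot u u.
Proof. by move=> h; rewrite lt_def dot_ge0 dot_eq0 h. Qed.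

Lemma mul_refl a v : refl a *m v = v - pairing v a *: a.
Proof.
rewrite /refl mulmxBl mul1mx -scalemxAl -mulmxA; congr (_ - _).
rewrite [a^T *m v]mx11_scalar -/(dot a v) mul_mx_scalar scalerA.
by congr (_ *: _); rewrite /pairing dotC mulrAC.
Qed.

Lemma trmx_refl a : (refl a)^T = refl a.
Proof. by rewrite /refl linearB /= trmx1 linearZ /= trmx_mul trmxK. Qed.

Lemma reflN a : refl (- a) = refl a.
Proof. by rewrite /refl dotNl dotNr opprK linearN /= mulNmx mulmxN opprK. Qed.

Lemma pairing_id a : a != 0 -> pairing a a = 2.
Proof.
by move/dot_gt0 => h; rewrite /pairing -mulrA divff ?mulr1 // gt_eqF.
Qed.

Lemma pairingDl u v a : pairing (u + v) a = pairing u a + pairing v a.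
Proof. by rewrite /pairing dotDl mulrDr mulrDl. Qed.

Lemma pairingZl u c a : pairing (c *: u) a = c * pairing u a.
Proof. by rewrite /pairing dotZl; ring. Qed.

Lemma pairingNl u a : pairing (- u) a = - pairing u a.
Proof. by rewrite /pairing dotNl mulrN mulNr. Qed.

Lemma pairingNr u a : pairing u (- a) = - pairing u a.
Proof. by rewrite /pairing !dotNr dotNl opprK mulrN mulNr. Qed.

Lemma pairing_suml (I : Type) (r : seq I) (F : I -> V) a :
  pairing (\sum_(i <- r) F i) a = \sum_(i <- r) pairing (F i) a.
Proof. by rewrite /pairing dot_suml mulr_sumr mulr_suml. Qed.

Lemma pairing_gt0 u a : a != 0 -> (0 < pairing u a) = (0 < dot u a).
Proof.
move/dot_gt0 => h; rewrite /pairing pmulr_lgt0 ?invr_gt0 //.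
by rewrite pmulr_rgt0.
Qed.

Lemma refl_id a : a != 0 -> refl a *m a = - a.
Proof. by move=> h; rewrite mul_refl pairing_id // scaler_nat mulr2n opprD addNKr. Qed.

Lemma reflK a v : a != 0 -> refl a *m (refl a *m v) = v.
Proof.
move=> h; rewrite [refl a *m v]mul_refl mulmxBr -scalemxAr refl_id // mul_refl.
by rewrite scalerN opprK subrK.
Qed.

Lemma eq_mulmx A w : (forall v, A *m v = w *m v) -> A = w.
Proof.
move=> h; apply/matrixP => i j; have := congr1 (fun M : V => M i 0) (h (delta_mx j 0)).
by rewrite -!colE !mxE.
Qed.

Lemma refl_sqr a : a != 0 -> refl a *m refl a = 1%:M.
Proof. by move=> h; apply: eq_mulmx => v; rewrite -mulmxA reflK // mul1mx. Qed.

Lemma refl_conj w a : w^T *m w = 1%:M -> w *m refl a = refl (w *m a) *m w.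
Proof.
move=> h; rewrite /refl dotM mulmxA h mul1mx mulmxBr mulmx1 mulmxBl mul1mx.
congr (_ - _); rewrite -scalemxAr -scalemxAl; congr (_ *: _).
by rewrite trmx_mul -!mulmxA h mulmx1.
Qed.

Lemma pairing_orth w u a : w^T *m w = 1%:M ->
  pairing (w *m u) (w *m a) = pairing u a.
Proof. by move=> h; rewrite /pairing !dotM !mulmxA h !mul1mx. Qed.

End Euclid.

(** * Roots and simple roots *)

Lemma count_lt (T : eqType) (p q : pred T) (s : seq T) x :
  subpred p q -> x \in s -> q x -> ~~ p x -> (count p s < count q s)%N.
Proof.
move=> pq; elim: s => //= y s IH; rewrite inE => /orP[/eqP <- qx /negPf px|xs qx px].
  by rewrite qx px add0n add1n ltnS sub_count.
rewrite -addnS leq_add //; last exact: IH.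
by case: (p y) (pq y) => // ->.
Qed.

Section Roots.
Variables (R : realFieldType) (n : nat).
Notation V := 'cV[R]_n.
Notation Mat := 'M[R]_n.
Variables (D Dp : seq V) (f : V).
Hypothesis HD : simple_root_system D.
Hypothesis f_neq0 : forall a, a \in D -> dot f a != 0.
Hypothesis Dp_def : forall a, (a \in Dp) = (a \in D) && (0 < dot f a).

Lemma root_neq0 a : a \in D -> a != 0.
Proof. by case: HD => -[_ _ h] _ aD; apply: contraNneq h => <-. Qed.

Lemma root_refl a b : a \in D -> b \in D -> refl a *m b \in D.
Proof. by case: HD => _ [_] [h _]; apply: h. Qed.

Lemma root_int a b : a \in D -> b \in D -> exists z : int, pairing b a = z%:~R.
Proof. by case: HD => _ [_] [_ [h _]]; apply: h. Qed.

Lemma root_scale a c : a \in D -> c *: a \in D -> c = 1 \/ c = -1.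
Proof. by case: HD => _ [_] [_ [_ [h _]]]; apply: h. Qed.

Lemma root_span v : (forall a, a \in D -> dot v a = 0) -> v = 0.
Proof. by case: HD => _ [h _]; apply: h. Qed.

Lemma rootN a : a \in D -> - a \in D.
Proof. by move=> aD; rewrite -refl_id ?root_neq0 // root_refl. Qed.

Lemma rootNE a : (- a \in D) = (a \in D).
Proof. by apply/idP/idP => /rootN; rewrite ?opprK. Qed.

(** If one of the two integral pairings is 1, a reflection produces [a - b] up to sign. If both are
    at least 2, [dot a b] bounds both squared norms and [a - b] has squared norm at most 0. *)
Lemma root_sub a b : a \in D -> b \in D -> a != b -> 0 < pairing a b -> a - b \in D.
Proof.
move=> aD bD nab; have [k Ek] := root_int bD aD; have [j Ej] := root_int aD bD.
have a0 := dot_gt0 (root_neq0 aD); have b0 := dot_gt0 (root_neq0 bD).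
rewrite pairing_gt0 ?root_neq0 // => ab0.
have k0 : 0 < k by rewrite -(ltr0z R) -Ek pairing_gt0 ?root_neq0.
have j0 : 0 < j by rewrite -(ltr0z R) -Ej pairing_gt0 ?root_neq0 // dotC.
have [k1|k1] := eqVneq k 1.
  by have := root_refl bD aD; rewrite mul_refl Ek k1 scale1r.
have [j1|j1] := eqVneq j 1.
  by have := root_refl aD bD; rewrite mul_refl Ej j1 scale1r -rootNE opprB.
have k2 : 2 <= pairing a b by rewrite Ek (ler_int R 2 k); lia.
have j2 : 2 <= pairing b a by rewrite Ej (ler_int R 2 j); lia.
move: k2 j2; rewrite /pairing (dotC b a) !ler_pdivlMr // => k2 j2.
have ba : dot b b <= dot a b by lra.
have aa : dot a a <= dot a b by lra.
have : dot (a - b) (a - b) == 0.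
  by rewrite eq_le dot_ge0 dotBr !dotBl (dotC b a); lra.
by rewrite dot_eq0 subr_eq0 (negPf nab).
Qed.

Lemma root_add a b : a \in D -> b \in D -> a != - b -> pairing a b < 0 -> a + b \in D.
Proof.
move=> aD bD nab h; rewrite -[b]opprK root_sub ?rootN //.
by rewrite pairingNr oppr_gt0.
Qed.

(* The recursion [d, d - g] (or [d, d + g]) moves the pairing with [g] by 2
   towards 0, and changes the reflected root by [g]. *)
Lemma indec_refl (P : pred V) g :
  {in D, forall a, P (- a) = ~~ P a} ->
  {in D &, forall a b, P a -> P b -> a + b \in D -> P (a + b)} ->
  g \in D -> P g ->
  {in D &, forall a b, P a -> P b -> a + b != g} ->
  forall d, d \in D -> P d -> d != g -> P (refl g *m d).
Proof.
move=> PN PD gD Pg ind d dD Pd dg; have [k] := root_int gD dD.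
have [m] := ubnP `|k|%N; elim: m d k dD Pd dg => // m IH d k dD Pd dg km Ek.
have rD := root_refl gD dD.
have ErD : refl g *m (d + g) = refl g *m d - g.
  by rewrite mulmxDr refl_id ?root_neq0.
have ErB : refl g *m (d - g) = refl g *m d + g.
  by rewrite mulmxBr refl_id ?root_neq0 // opprK.
have [k0|k0|k0] := ltrgtP k 0; last by rewrite mul_refl Ek k0 scale0r subr0.
- have kR : pairing d g < 0 by rewrite Ek ltrz0.
  have dgN : d != - g by apply: contraTneq Pd => ->; rewrite PN // Pg.
  have dgD : d + g \in D by rewrite root_add.
  have Pdg : P (d + g) by apply: PD.
  have [k1|k1] := eqVneq k (-1).
    by rewrite mul_refl Ek k1 scaleN1r opprK.
  have Pr : P (refl g *m (d + g)).
    apply: (IH _ (k + 2)) => //.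
    + by apply: contraNneq (root_neq0 dD) => h; rewrite -(addrK g d) h subrr.
    + by clear -k0 km k1; lia.
    + by rewrite pairingDl Ek pairing_id ?root_neq0 // rmorphD.
  rewrite -[refl g *m d](subrK g) -ErD.
  by apply: PD => //; [exact: root_refl | rewrite ErD subrK].
- have kR : 0 < pairing d g by rewrite Ek ltr0z.
  have dgD : d - g \in D by rewrite root_sub.
  have Pdg : P (d - g).
    apply: contraT; rewrite -PN // opprB => h.
    by have := ind _ _ dD (rootN dgD); rewrite opprB subrKC eqxx => /(_ Pd h).
  have [k1|k1] := eqVneq k 1; first by rewrite mul_refl Ek k1 scale1r.
  have Pr : P (refl g *m (d - g)).
    apply: (IH _ (k - 2)) => //.
    + apply: contraTneq dD => h; rewrite -(subrK g d) h -mulr2n -scaler_nat.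
      by apply/negP => /(root_scale gD) [] /eqP; lra.
    + by clear -k0 km k1; lia.
    + by rewrite pairingDl pairingNl Ek pairing_id ?root_neq0 // rmorphB.
  apply: contraT; rewrite -PN // => h.
  have := ind _ _ (root_refl gD dgD) (rootN rD) Pr h.
  by rewrite ErB addrC addKr eqxx.
Qed.

Lemma posD a : a \in Dp -> a \in D.
Proof. by rewrite Dp_def => /andP[]. Qed.

Lemma pos_gt0 a : a \in Dp -> 0 < dot f a.
Proof. by rewrite Dp_def => /andP[]. Qed.

Lemma posN a : a \in D -> (- a \in Dp) = (a \notin Dp).
Proof.
move=> aD; rewrite !Dp_def rootNE aD /= dotNr oppr_gt0 -leNgt le_eqVlt.
by rewrite (negPf (f_neq0 aD)).
Qed.

Lemma pos_add a b : a \in Dp -> b \in Dp -> a + b \in D -> a + b \in Dp.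
Proof. by move=> ha hb h; rewrite Dp_def h dotDr addr_gt0 ?pos_gt0. Qed.

(** Encoded by the action of the reflection instead of by indecomposability; [simple_or_sum]
    supplies the link. *)
Definition simple (a : V) : bool :=
  (a \in Dp) && all (fun b => (b != a) ==> (refl a *m b \in Dp)) Dp.

Lemma simpleP a b : simple a -> b \in Dp -> b != a -> refl a *m b \in Dp.
Proof. by case/andP=> _ /allP h /h /implyP; apply. Qed.

Lemma simple_pos a : simple a -> a \in Dp.
Proof. by case/andP. Qed.

(** A positive root that is not a sum of two positive roots meets the hypotheses of [indec_refl] for
    the predicate of positivity. *)
Lemma simple_or_sum a : a \in Dp ->
  simple a \/ exists b c, [/\ b \in Dp, c \in Dp & a = b + c].
Proof.
move=> aP; have [/hasP [b bP cP]|h] := boolP (has (fun b => a - b \in Dp) Dp).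
  by right; exists b, (a - b); rewrite subrKC.
left; rewrite /simple aP; apply/allP => b bP; apply/implyP => ba.
apply: (@indec_refl [pred x | x \in Dp]); rewrite ?posD //=.
- by move=> x xD /=; rewrite posN.
- by move=> x y _ _ /=; apply: pos_add.
move=> x y xD yD /= xP yP; apply: contraNneq h => <-.
by apply/hasP; exists x => //; rewrite addrC addKr.
Qed.

(** Induction on the number of positive roots with a smaller value of [dot f]; it stands in for the
    expansion in simple roots. *)
Lemma pos_ind (Q : V -> Prop) :
  (forall a, simple a -> Q a) ->
  (forall a b, a \in Dp -> b \in Dp -> a + b \in Dp -> Q a -> Q b -> Q (a + b)) ->
  forall a, a \in Dp -> Q a.
Proof.
move=> Q1 Q2 a; pose mu x := count (fun b => dot f b < dot f x) Dp.
have mu_lt x y : x \in Dp -> dot f x < dot f y -> (mu x < mu y)%N.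
  move=> xP xy; apply: (count_lt _ xP) => //=; last by rewrite ltxx.
  by move=> b /lt_trans; apply.
have [m] := ubnP (mu a); elim: m a => // m IH a am aP.
have [/Q1//|[b [c [bP cP E]]]] := simple_or_sum aP.
rewrite E in aP am *; have bc : dot f b < dot f (b + c) by rewrite dotDr ltrDl pos_gt0.
have cb : dot f c < dot f (b + c) by rewrite dotDr ltrDr pos_gt0.
apply: Q2 => //; apply: IH => //.
- by have := mu_lt _ _ bP bc; lia.
- by have := mu_lt _ _ cP cb; lia.
Qed.

Lemma dominant_pos y : (forall a, simple a -> 0 <= dot y a) ->
  forall a, a \in Dp -> 0 <= dot y a.
Proof.
move=> h; apply: pos_ind => // a b _ _ _ ha hb.
by rewrite dotDr addr_ge0.
Qed.

(** While the root is not simple, some simple [a] pairs positively with it, since otherwise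
    [dominant_pos] would make its squared norm nonpositive. Reflecting in [a] keeps it positive and
    lowers [dot f]. *)
Lemma pos_to_simple (S : Mat -> Prop) v x :
  (forall u a, simple a -> S u -> S (refl a *m u)) ->
  S v -> v *m x \in Dp -> exists2 u, S u & simple (u *m x).
Proof.
move=> HS; pose mu x := count (fun b => dot f b < dot f x) Dp.
have [m] := ubnP (mu (v *m x)); elim: m v => // m IH v vm Sv vP.
have [|ns] := boolP (simple (v *m x)); first by exists v.
have [a sa ha] : exists2 a, simple a & 0 < pairing (v *m x) a.
  apply: NNPP => h; have /dominant_pos/(_ _ vP) : forall a, simple a -> 0 <= dot (- (v *m x)) a.
    move=> a sa; rewrite dotNl oppr_ge0 leNgt; apply/negP => h'; apply: h.
    by exists a => //; rewrite pairing_gt0 // root_neq0 // posD // simple_pos.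
  by rewrite dotNl oppr_ge0 leNgt dot_gt0 // root_neq0 // posD.
have rP : refl a *m v *m x \in Dp.
  by rewrite -mulmxA simpleP //; apply: contraNneq ns => ->.
apply: (IH (refl a *m v)) => //; last exact: HS.
suff : (mu (refl a *m v *m x) < mu (v *m x))%N by lia.
have lt : dot f (refl a *m v *m x) < dot f (v *m x).
  rewrite -mulmxA mul_refl dotBr dotZr ltrBlDr ltrDl mulr_gt0 //.
  exact/pos_gt0/simple_pos.
apply: (count_lt _ rP) => //=; last by rewrite ltxx.
by move=> b /lt_trans; apply.
Qed.

End Roots.

(** * Weyl group and length *)

Lemma seq_choice (T : eqType) (U : Type) (P : T -> U -> Prop) (u0 : U) (s : seq T) :
  (forall x, x \in s -> exists y, P x y) ->
  exists g : T -> U, forall x, x \in s -> P x (g x).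
Proof.
elim: s => [|x s IH] h; first by exists (fun=> u0).
have [g hg] := IH (fun y ys => h y (@mem_behead _ (x :: s) y ys)).
have [y hy] := h x (mem_head _ _).
exists (fun z => if z == x then y else g z) => z.
by have [->//|zx] := eqVneq z x; rewrite inE (negPf zx); apply: hg.
Qed.

Lemma argmax_seq (T : eqType) (R : realFieldType) (F : T -> R) (Q : T -> Prop) (s : seq T) :
  (exists2 x, x \in s & Q x) ->
  exists x, [/\ x \in s, Q x & forall y, y \in s -> Q y -> F y <= F x].
Proof.
elim: s => [|x s IH] [x0 x0s Qx0]; first by [].
have [[y ys Qy]|hn] := classic (exists2 y, y \in s & Q y); last first.
  have E y : y \in x :: s -> Q y -> y = x.
    by rewrite inE => /orP[/eqP//|ys Qy]; case: hn; exists y.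
  exists x; split; [exact: mem_head | by rewrite -(E _ x0s Qx0) |].
  by move=> y ys Qy; rewrite (E y ys Qy).
have [z [zs Qz hz]] := IH (ex_intro2 _ _ y ys Qy).
have [Qx|nQx] := classic (Q x); last first.
  exists z; split; [by rewrite inE zs orbT|by []|].
  by move=> t; rewrite inE => /orP[/eqP->//|]; apply: hz.
have [xz|/ltW zx] := leP (F x) (F z).
  exists z; split; [by rewrite inE zs orbT|by []|].
  by move=> t; rewrite inE => /orP[/eqP->//|]; apply: hz.
exists x; split; [exact: mem_head|by []|].
move=> t; rewrite inE => /orP[/eqP->//|ts Qt].
exact: le_trans (hz t ts Qt) zx.
Qed.

Lemma perm_involution (T : eqType) (s : seq T) (h : T -> T) :
  uniq s -> {in s, forall x, h x \in s} -> {in s, involutive h} ->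
  perm_eq [seq h x | x <- s] s.
Proof.
move=> us hs hK; apply: uniq_perm => //.
  by rewrite map_inj_in_uniq // => x y xs ys E; rewrite -(hK x xs) E hK.
move=> y; apply/mapP/idP => [[x xs ->]|ys]; first exact: hs.
by exists (h y); rewrite ?hs ?hK.
Qed.

(** Adding the sum reindexed along [h] reduces its sign to a termwise comparison of [B x] with
    [B (h x)]. *)
Lemma sum_involution (T : eqType) (R : realFieldType) (s : seq T) (h : T -> T)
    (B : pred T) (g : T -> R) :
  uniq s -> {in s, forall x, h x \in s} -> {in s, involutive h} ->
  {in s, forall x, g (h x) = - g x} ->
  2 * (\sum_(x <- s) (B x)%:R * g x) = \sum_(x <- s) ((B x)%:R - (B (h x))%:R) * g x.
Proof.
move=> us hs hK hg; rewrite -[2]/(1 + 1) mulrDl !mul1r.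
rewrite -{2}(perm_big _ (perm_involution us hs hK)) /= big_map -big_split /=.
by apply: eq_big_seq => x xs; rewrite hg // mulrN mulrBl.
Qed.

Section Weyl.
Variables (R : realFieldType) (n : nat).
Notation V := 'cV[R]_n.
Notation Mat := 'M[R]_n.
Variables (D Dp : seq V) (f : V).
Hypothesis HD : simple_root_system D.
Hypothesis Dp_uniq : uniq Dp.
Hypothesis f_neq0 : forall a, a \in D -> dot f a != 0.
Hypothesis Dp_def : forall a, (a \in Dp) = (a \in D) && (0 < dot f a).

Local Notation W := (inW D).
Local Notation len := (wlength Dp).
Let D0 := root_neq0 HD.
Let PD := posD Dp_def.
Let PN := posN HD f_neq0 Dp_def.

Lemma W1 : W 1%:M.
Proof. by exists [::]. Qed.

Lemma W_mul u v : W u -> W v -> W (u *m v).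
Proof.
case=> s [sD ->] [r [rD ->]]; exists (s ++ r); split; first by rewrite all_cat sD.
by elim: s {sD} => [|a s IH] /=; rewrite ?mul1mx // -IH mulmxA.
Qed.

Lemma W_refl a : a \in D -> W (refl a).
Proof. by move=> aD; exists [:: a]; rewrite /= aD mulmx1. Qed.

Lemma W_ind (P : Mat -> Prop) :
  P 1%:M -> (forall a u, a \in D -> W u -> P u -> P (refl a *m u)) -> forall u, W u -> P u.
Proof.
move=> P1 PS u [s [sD ->]]; elim: s sD => //= a s IH /andP[aD sD].
by apply: PS => //; [exists s | exact: IH].
Qed.

Lemma W_orth u : W u -> u^T *m u = 1%:M.
Proof.
elim/W_ind => [|a v aD _ IH]; first by rewrite trmx1 mul1mx.
by rewrite trmx_mul trmx_refl -mulmxA (mulmxA (refl a)) refl_sqr ?D0 // mul1mx.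
Qed.

Lemma W_orthr u : W u -> u *m u^T = 1%:M.
Proof. by move/W_orth/mulmx1C. Qed.

Lemma W_tr u : W u -> W u^T.
Proof.
elim/W_ind => [|a v aD _ IH]; first by rewrite trmx1; apply: W1.
by rewrite trmx_mul trmx_refl; apply: W_mul => //; apply: W_refl.
Qed.

Lemma W_root u a : W u -> a \in D -> u *m a \in D.
Proof.
move=> + aD; elim/W_ind => [|b v bD _ IH]; first by rewrite mul1mx.
by rewrite -mulmxA (root_refl HD).
Qed.

Lemma mulTK (u : Mat) (x : V) : W u -> u^T *m (u *m x) = x.
Proof. by move=> Wu; rewrite mulmxA W_orth // mul1mx. Qed.

Lemma mulKT (u : Mat) (x : V) : W u -> u *m (u^T *m x) = x.
Proof. by move=> Wu; rewrite mulmxA W_orthr // mul1mx. Qed.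

Lemma W_reflr u a : W u -> a \in D -> W (u *m refl a).
Proof. by move=> Wu aD; apply: W_mul => //; apply: W_refl. Qed.

Lemma W_refll u a : W u -> a \in D -> W (refl a *m u).
Proof. by move=> Wu aD; apply: W_mul => //; apply: W_refl. Qed.

(** The roots span the space, so an element of [W] is determined by its action on the roots,
    recorded by [code]; there are finitely many codes. *)
Lemma W_finite : exists Ws : seq Mat, uniq Ws /\ forall w, w \in Ws <-> W w.
Proof.
pose d := size D.
pose code (w : Mat) := [ffun i : 'I_d => inord (index (w *m D`_i) D) : 'I_d.+1].
have code_inj u v : W u -> W v -> code u = code v -> u = v.
  move=> Wu Wv E; apply/eqP; rewrite -subr_eq0; apply/eqP/row_matrixP => i.
  rewrite row0; apply: trmx_inj; rewrite trmx0; apply: (root_span HD) => a aD.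
  suff : (u - v) *m a = 0 by rewrite /dot trmxK -row_mul => ->; rewrite row0 mxE.
  rewrite mulmxBl; apply/eqP; rewrite subr_eq0; apply/eqP.
  have ia : (index a D < d)%N by rewrite index_mem.
  have := congr1 (fun c : {ffun 'I_d -> 'I_d.+1} => c (Ordinal ia) : nat) E.
  rewrite !ffunE /= nth_index // !inordK ?ltnS ?index_size // => /(congr1 (nth 0 D)).
  by rewrite !nth_index ?W_root.
suff [Ws [h1 h2]] : exists Ws : seq Mat, (forall w, w \in Ws -> W w) /\
    forall w, W w -> code w \in enum (predT : pred {ffun 'I_d -> 'I_d.+1}) -> w \in Ws.
  exists (undup Ws); rewrite undup_uniq; split=> // w; rewrite mem_undup.
  by split=> [/h1|Ww] //; apply: h2 => //; rewrite mem_enum.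
elim: (enum _) => [|c l [Ws [h1 h2]]]; first by exists [::].
have [[w0 Ww0 cw0]|hn] := classic (exists2 w0, W w0 & code w0 = c).
  exists (w0 :: Ws); split=> w; first by rewrite inE => /orP[/eqP->|/h1].
  move=> Ww; rewrite !inE -cw0 => /orP[/eqP|] h; last by rewrite h2 ?orbT.
  by rewrite (code_inj _ _ Ww Ww0 h) eqxx.
exists Ws; split=> // w Ww; rewrite inE => /orP[/eqP h|]; last exact: h2.
by case: hn; exists w.
Qed.

(** The map [h] sends the inversions of [u] injectively to inversions of [u *m refl b] and misses
    the inversion [b]. *)
Lemma len_refl_gt u b : W u -> b \in Dp -> u *m b \in Dp ->
  (len u < len (u *m refl b))%N.
Proof.
move=> Wu bP ubP; have bD := PD bP.
pose h (a : V) := if refl b *m a \in Dp then refl b *m a else a.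
rewrite /wlength -!size_filter -(size_map h [seq a <- Dp | _]) -/(size (b :: _)).
apply: uniq_leq_size => /=.
  rewrite map_inj_in_uniq ?filter_uniq // ?andbT.
    apply/mapP => -[a]; rewrite mem_filter /h => /andP[uaN aP] E.
    move: E uaN; case: ifP => [ra E|_ <-].
      by move: ra; rewrite -E bP -[a](reflK _ (D0 bD)) -E refl_id ?D0 // PN //; move: aP;
        rewrite -[a](reflK _ (D0 bD)) -E refl_id ?D0 // PN // bP.
    by rewrite PN ?W_root // ubP.
  move=> x y; rewrite !mem_filter /h => /andP[_ xP] /andP[_ yP].
  case: ifP => rx; case: ifP => ry //.
  - by move=> E; rewrite -[x](reflK _ (D0 bD)) E reflK ?D0.
  - by move=> E; move: ry; rewrite -E reflK ?D0 // xP.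
  - by move=> E; move: rx; rewrite E reflK ?D0 // yP.
move=> x; rewrite inE => /orP[/eqP->|/mapP[a]].
  by rewrite mem_filter -mulmxA refl_id ?D0 // mulmxN opprK ubP.
rewrite mem_filter => /andP[uaN aP]; rewrite /h; case: ifP => ra ->.
  by rewrite mem_filter ra andbT -mulmxA reflK ?D0.
have aD := PD aP; rewrite mem_filter aP andbT -mulmxA.
have rN : - (refl b *m a) \in Dp by rewrite PN ?ra // (root_refl HD).
have k0 : 0 < pairing a b.
  move: (pos_gt0 Dp_def rN) (pos_gt0 Dp_def aP) (pos_gt0 Dp_def bP).
  rewrite mul_refl dotNr dotBr dotZr => h1 h2 h3.
  by rewrite -(pmulr_lgt0 _ h3); lra.
rewrite Dp_def rootNE // W_root // ?(root_refl HD) //=.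
rewrite mul_refl mulmxBr -scalemxAr opprB dotBr dotZr.
move: (pos_gt0 Dp_def uaN) (pos_gt0 Dp_def ubP); rewrite dotNr => h1 h2.
by have := mulr_gt0 k0 h2; lra.
Qed.

Lemma len_refl_lt u b : W u -> b \in Dp -> u *m b \notin Dp ->
  (len (u *m refl b) < len u)%N.
Proof.
move=> Wu bP ubP; have bD := PD bP.
have := @len_refl_gt (u *m refl b) b (W_reflr Wu bD) bP.
rewrite -!mulmxA refl_id ?D0 // refl_sqr ?D0 // mulmx1 mulmxN; apply.
by rewrite PN ?W_root.
Qed.

(** [refl a] changes the sign of no root but [a] and [- a], so the two inversion sets differ only in
    [u^T *m a]. *)
Lemma len_simple u a : W u -> simple Dp a -> u^T *m a \in Dp ->
  len (refl a *m u) = (len u).+1.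
Proof.
move=> Wu sa uaP; have aP := simple_pos sa; have aD := PD aP.
rewrite /wlength -!sum1_count !(big_mkcond (fun b => _ \in Dp)) /=.
have -> : (\sum_(b <- Dp) (if - (u *m b)%R \in Dp then 1 else 0)).+1%N =
   (\sum_(b <- Dp) ((if - (u *m b)%R \in Dp then 1 else 0) + (b == u^T *m a)))%N.
  rewrite big_split /= -[in RHS](big_mkcond (fun b => b == _) (fun=> 1%N)) /=.
  rewrite sum1_count; have := count_uniq_mem (u^T *m a) Dp_uniq.
  by rewrite uaP /= => ->; rewrite addn1.
apply: eq_big_seq => b bP; have bD := PD bP; rewrite -mulmxA.
have ubD := W_root Wu bD.
have [E|nE] := eqVneq b (u^T *m a).
  by rewrite E mulKT // refl_id ?D0 // opprK aP PN // aP.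
rewrite addn0 !PN ?(root_refl HD) //.
have nua : u *m b != a by apply: contraNneq nE => <-; rewrite mulTK.
have nuna : - (u *m b) != a.
  apply: contraTneq bP => E; move: uaP; rewrite -E mulmxN mulTK //.
  by rewrite PN.
have [ubP|ubN] := boolP (u *m b \in Dp); first by rewrite (simpleP sa).
have : - (u *m b) \in Dp by rewrite PN.
by move/(simpleP sa)/(_ nuna); rewrite mulmxN PN ?(root_refl HD) // => ->.
Qed.

End Weyl.

(** * Highest roots and heights of coroots *)

Section Theta.
Variables (R : realFieldType) (n : nat).
Notation V := 'cV[R]_n.
Notation Mat := 'M[R]_n.
Variables (D Dp : seq V) (f : V).
Hypothesis HD : simple_root_system D.
Hypothesis Dp_uniq : uniq Dp.
Hypothesis f_neq0 : forall a, a \in D -> dot f a != 0.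
Hypothesis Dp_def : forall a, (a \in Dp) = (a \in D) && (0 < dot f a).

Local Notation W := (inW D).
Local Notation len := (wlength Dp).
Let D0 := root_neq0 HD.
Let PD := posD Dp_def.
Let PN := posN HD f_neq0 Dp_def.
Let P0 := pos_gt0 Dp_def.

(* [th] has maximal height among the roots in [a + cone]; the condition on [y]
   says, by duality, that [th - a] is a nonnegative combination of simple roots. *)
Lemma highest_root a : simple Dp a -> exists th, [/\ th \in Dp,
  forall y, (forall b, simple Dp b -> 0 <= dot y b) -> dot y a <= dot y th &
  forall g, g \in Dp -> g != th ->
    pairing g th = 0 \/ pairing g th = 1 /\ th - g \in Dp].
Proof.
move=> sa; have aP := simple_pos sa.
pose Q (x : V) := forall y, (forall b, simple Dp b -> 0 <= dot y b) -> dot y a <= dot y x.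
have [th [thP Qth hth]] : exists x, [/\ x \in Dp, Q x & forall y, y \in Dp -> Q y ->
  dot f y <= dot f x].
  by apply: (argmax_seq (dot f)); exists a.
have thD := PD thP; have fth := P0 thP.
have dom y : (forall b, simple Dp b -> 0 <= dot y b) -> forall b, b \in Dp -> 0 <= dot y b.
  by move=> hy; apply: (dominant_pos HD f_neq0 Dp_def).
(* Such a root would satisfy [Q] and lie higher than [th]. *)
have big c x : x \in Dp -> 1 <= c -> c *: th + x \in D -> False.
  move=> xP c1 xD; have fx := P0 xP.
  have fcx : dot f th < dot f (c *: th + x).
    by rewrite dotDr dotZr; have := ler_wpM2r (ltW fth) c1; lra.
  have cxP : c *: th + x \in Dp by rewrite Dp_def xD; lra.
  have Qcx : Q (c *: th + x).
    move=> y hy; have := Qth y hy; have y1 := dom y hy th thP; have := dom y hy x xP.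
    by rewrite dotDr dotZr; have := ler_wpM2r y1 c1; lra.
  by have := lt_le_trans fcx (hth _ cxP Qcx); rewrite ltxx.
exists th; split=> // g gP gth; have gD := PD gP.
have [k Ek] := root_int HD thD gD.
have rD := root_refl HD thD gD; have := rD; rewrite mul_refl => rD'.
have [k0|k0|k0] := ltrgtP k 0; last by left; rewrite Ek k0.
- exfalso; apply: (big (- pairing g th) g) => //; last by rewrite scaleNr addrC.
  by rewrite Ek -[1]/(1%:~R) -rmorphN ler_int; clear -k0; lia.
- have kR : 0 < pairing g th by rewrite Ek ltr0z.
  have sD : g - th \in D by apply: (root_sub HD).
  have tgP : th - g \in Dp.
    rewrite -opprB PN //; apply/negP => h; apply: (big 1 _ h) => //.
    by rewrite scale1r subrKC.
  have [k1|k1] := eqVneq k 1; first by right; rewrite Ek k1.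
  (* The root used is the negative of [refl th *m g]; the pairing is at least 2 here, so the
     coefficient of [th] is at least 1. *)
  exfalso; apply: (big (pairing g th - 1) (th - g)) => //.
    by rewrite Ek -[1]/(1%:~R) -rmorphB ler_int; clear -k0 k1; lia.
  by rewrite scalerBl scale1r addrA subrK -opprB (rootNE HD).
Qed.

Definition quasi_minuscule (th : V) : Prop :=
  th \in Dp /\ forall g, g \in Dp -> g != th ->
    pairing g th = 0 \/ pairing g th = 1 /\ th - g \in Dp.

(** Away from [th] and [- th], the reflection fixes a root or changes its sign, and the pairing
    tells in which direction; a power of [t] makes up for these sign changes in [theta_move]. *)
Lemma theta_cases th c : quasi_minuscule th -> c \in D -> c != th -> c != - th ->
  [\/ pairing c th = 0,
      [/\ pairing c th = 1, c \in Dp & refl th *m c \notin Dp] |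
      [/\ pairing c th = -1, c \notin Dp & refl th *m c \in Dp]].
Proof.
case=> thP hth cD cth cNth; have [cP|cN] := boolP (c \in Dp).
  have [E|[E h]] := hth c cP cth; [by constructor 1|constructor 2].
  split=> //; rewrite mul_refl E scale1r -PN ?opprB //.
  by rewrite -(rootNE HD) opprB PD.
have mcP : - c \in Dp by rewrite PN.
have mcth : - c != th by rewrite eqr_oppLR.
have [E|[E h]] := hth _ mcP mcth.
  by constructor 1; rewrite -[c]opprK pairingNl E oppr0.
constructor 3; move: E; rewrite pairingNl => E.
have {}E : pairing c th = -1 by rewrite -E opprK.
by split=> //; rewrite mul_refl E scaleN1r opprK addrC -[X in _ + X]opprK.
Qed.

(** Integrality, which holds because twice [rho] is a sum of roots, allows the value to serve as an
    exponent of [t]. *)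
Lemma exists_height :
  exists H : V -> int, forall g, g \in D -> 2 * pairing (rho Dp) g = (H g)%:~R.
Proof.
apply: (seq_choice (P := fun g (z : int) => 2 * pairing (rho Dp) g = z%:~R)) => [|g gD];
  first exact: 0.
have E : 2 * pairing (rho Dp) g = \sum_(a <- Dp) pairing a g.
  by rewrite /rho pairingZl mulrA divff ?mul1r ?pnatr_eq0 // pairing_suml.
rewrite E; have : {subset Dp <= D} by [].
elim: Dp => [|a s IH] sD; first by exists 0; rewrite big_nil.
have [z Ez] := IH (fun x xs => sD x (@mem_behead _ (a :: s) x xs)).
have [k Ek] := root_int HD gD (sD a (mem_head _ _)).
by exists (k + z); rewrite big_cons Ek Ez rmorphD.
Qed.

Variable H : V -> int.
Hypothesis HE : forall g, g \in D -> 2 * pairing (rho Dp) g = (H g)%:~R.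

Lemma height_sum g : g \in D -> (H g)%:~R = \sum_(a <- Dp) pairing a g :> R.
Proof.
move=> gD; rewrite -HE // /rho pairingZl mulrA divff ?mul1r ?pnatr_eq0 //.
by rewrite pairing_suml.
Qed.

Lemma heightN g : g \in D -> H (- g) = - H g.
Proof.
move=> gD; apply: (@intr_inj R).
by rewrite rmorphN /= -!HE ?(rootNE HD) // pairingNr mulrN.
Qed.

(** [H] is linear on coroots, and the coroot of [refl b *m x] is that of [x] minus [k] times that of
    [b]. *)
Lemma height_refl b x k : b \in D -> x \in D -> pairing b x = k%:~R ->
  H (refl b *m x) = H x - k * H b.
Proof.
move=> bD xD Ek; apply: (@intr_inj R).
rewrite rmorphB rmorphM /= -!HE ?(root_refl HD) // -Ek.
have := dot_gt0 (D0 bD); have := dot_gt0 (D0 xD) => x0 b0.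
have bb : dot b b != 0 by rewrite gt_eqF.
have xx : dot x x != 0 by rewrite gt_eqF.
have -> : pairing (rho Dp) (refl b *m x) = 2 * dot (rho Dp) (refl b *m x) / dot x x.
  by rewrite /pairing [in X in _ / X]dotM trmx_refl reflK ?D0.
rewrite mul_refl /pairing dotBr dotZr (dotC b x).
by field; rewrite bb xx.
Qed.

(* Pairing each root with its image under [refl b] only leaves the positive
   roots made negative by [refl b], all of which have positive pairing with [b]. *)
Lemma height_gt0 b : b \in Dp -> 0 < H b.
Proof.
move=> bP; have bD := PD bP; rewrite -(ltr0z R) height_sum //.
have D_uniq : uniq D by case: HD => -[].
have -> : \sum_(a <- Dp) pairing a b = \sum_(a <- D) (a \in Dp)%:R * pairing a b.
  transitivity (\sum_(a <- D | a \in Dp) pairing a b); last first.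
    by rewrite big_mkcond; apply: eq_bigr => a _; case: ifP; rewrite ?mul1r ?mul0r.
  rewrite -[RHS]big_filter; apply: perm_big; apply: uniq_perm => //.
    by rewrite filter_uniq.
  by move=> a; rewrite mem_filter; apply/idP/andP => [h|[]//]; rewrite PD.
rewrite -(pmulr_rgt0 _ (ltr0Sn R 1)) (@sum_involution _ _ _ (fun a =>
  refl b *m a) (mem Dp)) //; last first.
- move=> a aD; apply/eqP; rewrite -eqr_oppLR -pairingNr -refl_id ?D0 //.
  by rewrite pairing_orth // trmx_refl refl_sqr ?D0.
- by move=> a aD; rewrite reflK ?D0.
- by move=> a aD; apply: (root_refl HD).
have term a : a \in D -> 0 <= ((a \in Dp)%:R - (refl b *m a \in Dp)%:R) * pairing a b.
  move=> aD; have raD := root_refl HD bD aD; have fb := P0 bP.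
  have E : dot f (refl b *m a) = dot f a - pairing a b * dot f b.
    by rewrite mul_refl dotBr dotZr.
  have [aP|aN] := boolP (a \in Dp); have [rP|rN] := boolP (refl b *m a \in Dp);
    rewrite ?subrr ?mul0r ?subr0 ?sub0r ?mul1r ?mulN1r //.
    have := P0 aP; have : - (refl b *m a) \in Dp by rewrite PN.
    move/P0; rewrite dotNr E => h1 h2; rewrite leNgt; apply/negP => h3.
    by have := mulr_gt0 fb; move/(_ (- pairing a b)); rewrite oppr_gt0 mulrN => /(_ h3); lra.
  have := P0 rP; have : - a \in Dp by rewrite PN.
  move/P0; rewrite dotNr E => h1 h2; rewrite oppr_ge0 leNgt; apply/negP => h3.
  by have := mulr_gt0 h3 fb; lra.
rewrite (big_rem b) //= bP refl_id ?D0 // PN // bP subr0 mul1r pairing_id ?D0 //.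
have : 0 <= \sum_(y <- rem b D) ((y \in Dp)%:R - (refl b *m y \in Dp)%:R) * pairing y b.
  by rewrite big_seq sumr_ge0 // => y /mem_rem; apply: term.
lra.
Qed.

(** The affine counterpart of [len_simple]. With the height expanded as a sum of pairings with the
    positive roots, the sign changes of [theta_cases] are offset term by term; the extra 1 comes
    from [u^T *m (- th)]. *)
Lemma len_theta th u : quasi_minuscule th -> W u -> u^T *m (- th) \in Dp ->
  (len (refl th *m u))%:Z + H (u^T *m (- th)) = (len u).+1%:Z.
Proof.
move=> qth Wu uthP; have thP := qth.1; have thD := PD thP.
have uth : u^T *m th \in D by rewrite (W_root HD) //; apply: W_tr.
have lenE v : (len v)%:R = \sum_(b <- Dp) (- (v *m b) \in Dp)%:R :> R.
  by rewrite /wlength -sum1_count natr_sum big_mkcond; apply: eq_bigr => b _; case: ifP.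
apply: (@intr_inj R); rewrite rmorphD /= -!pmulrn mulmxN heightN // rmorphN /=.
rewrite height_sum // -(addn1 (len u)) natrD !lenE.
apply/eqP; rewrite subr_eq -addrA; apply/eqP.
have E1 : 1 = \sum_(b <- Dp) (b == u^T *m (- th))%:R :> R.
  rewrite -(@natr_sum R) -(@big_mkcond _ _ _ _ _ (fun b => b == _) (fun=> 1%N)) sum1_count.
  by have := count_uniq_mem (u^T *m (- th)) Dp_uniq; rewrite uthP => ->.
rewrite [X in _ = _ + (X + _)]E1 -!big_split /=; apply: eq_big_seq => b bP; have bD := PD bP.
have ubD := W_root HD Wu bD; rewrite -mulmxA.
have -> : pairing b (u^T *m th) = pairing (u *m b) th.
  by rewrite -(pairing_orth _ _ (W_orth HD Wu)) (mulKT HD).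
have [E|nE] := eqVneq b (u^T *m - th).
  have ub : u *m b = - th by rewrite E (mulKT HD).
  rewrite ub mulmxN refl_id ?D0 // !opprK thP PN // thP /= pairingNl pairing_id ?D0 //.
  by rewrite mulr0n; lra.
have c1 : u *m b != - th by apply: contraNneq nE => <-; rewrite (mulTK HD).
have c2 : u *m b != th.
  apply: contraTneq bP => E; move: uthP; rewrite -E mulmxN (mulTK HD) //.
  by rewrite PN.
rewrite !PN ?(root_refl HD) //.
have [E|[E h1 h2]|[E h1 h2]] := theta_cases qth ubD c2 c1.
- by rewrite mul_refl E scale0r subr0 mulr0n !addr0.
- by rewrite E h1 h2 /= mulr0n mulr1n; lra.
- by rewrite E h1 h2 /= mulr0n mulr1n; lra.
Qed.

End Theta.

(** * The weighted sum over monotone sequences *)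

Lemma convex_lt (R : realFieldType) (s x y z : R) :
  0 <= s -> s < 1 -> 1 < x -> y <= x -> z <= 1 -> x = s * y + (1 - s) * z -> False.
Proof.
move=> s0 s1 x1 yx z1 E; have := ler_wpM2l s0 yx.
have s1' : 0 < 1 - s by rewrite subr_gt0.
have := ler_wpM2l (ltW s1') z1; have : (1 - s) * 1 < (1 - s) * x by rewrite ltr_pM2l.
by rewrite mulr1 !mulrBl !mul1r in E *; lra.
Qed.

Section Transfer.
Variables (R : realFieldType) (n : nat).
Notation V := 'cV[R]_n.
Notation Mat := 'M[R]_n.
Variables (D Dp : seq V) (f : V).
Hypothesis HD : simple_root_system D.
Hypothesis Dp_uniq : uniq Dp.
Hypothesis f_neq0 : forall a, a \in D -> dot f a != 0.
Hypothesis Dp_def : forall a, (a \in Dp) = (a \in D) && (0 < dot f a).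

Local Notation W := (inW D).
Local Notation len := (wlength Dp).
Let D0 := root_neq0 HD.
Let DN := rootNE HD.
Let Drefl := root_refl HD.
Let PD := posD Dp_def.
Let PN := posN HD f_neq0 Dp_def.
Let Wr := W_root HD.

Variable L : seq V.
Hypothesis HL : reflection_order Dp L.

Local Lemma memL a : (a \in L) = (a \in Dp).
Proof. by case: HL => /perm_mem. Qed.

Local Lemma uniqL : uniq L.
Proof. by case: HL => /perm_uniq ->. Qed.

Local Definition rk (a : V) : nat := index a L.

Local Lemma rk_between a b : a \in Dp -> b \in Dp -> a + b \in Dp ->
  (rk a < rk (a + b)%R < rk b)%N \/ (rk b < rk (a + b)%R < rk a)%N.
Proof. by case: HL => _ h aP bP abP; apply/orP; apply: h. Qed.

(* The positive system reached after flipping the signs of the roots of [S]. *)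
Definition flipped (S : seq V) (g : V) : bool :=
  (g \in Dp) (+) ((g \in S) || (- g \in S)).

(** * Positive systems attached to initial segments of a reflection order *)

Section Prefix.
Variables (S : seq V) (b : V) (rest : seq V).
Hypothesis EL : L = S ++ b :: rest.

Local Lemma next_pos : b \in Dp.
Proof. by rewrite -memL EL mem_cat mem_head orbT. Qed.

Local Lemma subS a : a \in S -> a \in Dp.
Proof. by rewrite -memL EL mem_cat => ->. Qed.

Local Lemma mem_prefix a : (a \in S) = (rk a < size S)%N.
Proof.
rewrite /rk EL index_cat; case: ifP => h; first by rewrite index_mem h.
by apply/esym/negbTE; rewrite -leqNgt leq_addr.
Qed.

Local Lemma rk_b : rk b = size S.
Proof.
have := uniqL; rewrite /rk EL cat_uniq index_cat => /and3P[_ /norP[/negPf -> _] _].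
by rewrite /= eqxx addn0.
Qed.

Lemma flipped_pos a : a \in Dp -> flipped S a = (size S <= rk a)%N.
Proof.
move=> aP; rewrite /flipped aP mem_prefix [RHS]leqNgt.
case: (boolP (- a \in S)) => [/subS|_]; last by rewrite orbF.
by rewrite PN ?PD // aP.
Qed.

Lemma flippedN T a : a \in D -> flipped T (- a) = ~~ flipped T a.
Proof. by move=> aD; rewrite /flipped PN // opprK orbC addNb. Qed.

Lemma flipped_neg a : - a \in Dp -> flipped S a = (rk (- a)%R < size S)%N.
Proof.
move=> aP; have := flippedN S (PD aP); rewrite opprK => ->.
by rewrite flipped_pos // -ltnNge.
Qed.

(** The rank of a sum of positive roots lies between those of the summands. For summands of opposite
    signs this is applied to [x], [- y] and the positive one of [x + y] and [- (x + y)]. *)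
Lemma flipped_add : {in D &, forall x y, flipped S x -> flipped S y ->
  x + y \in D -> flipped S (x + y)}.
Proof.
have mixed x y : x \in Dp -> - y \in Dp -> flipped S x -> flipped S y ->
    x + y \in D -> flipped S (x + y).
  move=> xP yP; rewrite (flipped_pos xP) (flipped_neg yP) => hx hy eD.
  have [eP|] := boolP (x + y \in Dp).
    have := @rk_between (x + y) (- y) eP yP; rewrite addrK => /(_ xP) h.
    by rewrite flipped_pos //; clear -h hx hy; lia.
  rewrite -PN // => eP.
  have E : x - (x + y) = - y by rewrite opprD addrA subrr add0r.
  have h := @rk_between x (- (x + y)) xP eP; rewrite E in h; have {}h := h yP.
  by rewrite flipped_neg //; clear -h hx hy; lia.
move=> x y xD yD; have [xP|xN] := boolP (x \in Dp); have [yP|yN] := boolP (y \in Dp).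
- move=> + + eD; have eP := pos_add Dp_def xP yP eD.
  rewrite !flipped_pos // => hx hy.
  by have h := rk_between xP yP eP; clear -h hx hy; lia.
- by move=> hx hy eD; apply: mixed; rewrite ?PN.
- by move=> hx hy; rewrite addrC => eD; apply: mixed; rewrite ?PN.
move: xN yN; rewrite -!PN // => xP yP + + eD.
have eP : - x + - y \in Dp by apply: (pos_add Dp_def) => //; rewrite -opprD DN.
have h := rk_between xP yP eP; have E : - x + - y = - (x + y) by rewrite opprD.
rewrite E in eP h.
by rewrite !flipped_neg // => hx hy; clear -h hx hy; lia.
Qed.

(** [b] is the first root not yet flipped, which rules out every decomposition. With [flipped_add]
    this gives the hypotheses of [indec_refl] for [flipped S]. *)
Lemma flipped_indec : {in D &, forall x y, flipped S x -> flipped S y -> x + y != b}.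
Proof.
have mixed x y : x \in Dp -> - y \in Dp -> flipped S x -> flipped S y -> x + y != b.
  move=> xP yP; rewrite (flipped_pos xP) (flipped_neg yP) => hx hy; apply/eqP => E.
  have := @rk_between b (- y) next_pos yP; rewrite -E addrK => /(_ xP); rewrite E rk_b.
  by clear -hx hy => h; lia.
move=> x y xD yD; have [xP|xN] := boolP (x \in Dp); have [yP|yN] := boolP (y \in Dp).
- rewrite !flipped_pos // => hx hy; apply/eqP => E.
  have := @rk_between x y xP yP; rewrite E rk_b => /(_ next_pos).
  by clear -hx hy => h; lia.
- by move=> hx hy; apply: mixed; rewrite ?PN.
- by move=> hx hy; rewrite addrC; apply: mixed; rewrite ?PN.
move: xN yN; rewrite -!PN // => xP yP _ _; apply/eqP => E.
have : - x + - y \in Dp by apply: (pos_add Dp_def); rewrite // -opprD E DN PD // next_pos.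
by rewrite -opprD E PN ?next_pos // PD // next_pos.
Qed.

Lemma flipped_refl g : g \in D -> g != b -> g != - b ->
  flipped S (refl b *m g) = flipped S g.
Proof.
have Sb : flipped S b by rewrite flipped_pos ?next_pos // rk_b.
have bD : b \in D by rewrite PD ?next_pos.
have sub x : x \in D -> flipped S x -> x != b -> flipped S (refl b *m x).
  apply: (indec_refl HD (P := flipped S)) => //.
  - by move=> y yD /=; apply: flippedN.
  - exact: flipped_add.
  - exact: flipped_indec.
move=> gD gb gNb; have [Sg|NSg] := boolP (flipped S g); first by rewrite sub.
have := sub (- g); rewrite DN eqr_oppLR mulmxN !flippedN // ?Drefl //.
by move=> /(_ gD NSg gNb)/negPf.
Qed.

Lemma flipped_rcons g : g \in D -> g != b -> g != - b ->
  flipped (rcons S b) g = flipped S g.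
Proof.
move=> gD gb gNb; rewrite /flipped !mem_rcons !inE (negPf gb) eqr_oppLR.
by rewrite (negPf gNb).
Qed.

Lemma flipped_rcons_b : flipped (rcons S b) b = false.
Proof. by rewrite /flipped next_pos mem_rcons mem_head. Qed.

Lemma flipped_b : flipped S b.
Proof. by rewrite flipped_pos ?next_pos // rk_b. Qed.

(** [refl b] exchanges the positive systems before and after [b]; hence a step taken along [b]
    leaves the chamber in place. *)
Lemma flipped_step x : x \in D ->
  flipped (rcons S b) (refl b *m x) = flipped S x.
Proof.
move=> xD; have bD : b \in D by rewrite PD ?next_pos.
have [->|xb] := eqVneq x b.
  by rewrite refl_id ?D0 // flippedN // flipped_rcons_b flipped_b.
have [->|xNb] := eqVneq x (- b).
  by rewrite mulmxN refl_id ?D0 // opprK flippedN // flipped_rcons_b flipped_b.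
rewrite flipped_rcons ?flipped_refl ?Drefl //.
- by apply: contraNneq xNb => E; rewrite -[x](reflK _ (D0 bD)) E refl_id ?D0.
- by apply: contraNneq xb => E; rewrite -[x](reflK _ (D0 bD)) E mulmxN refl_id ?D0 // opprK.
Qed.

End Prefix.

(** * Weights of steps, and moves by simple and highest roots *)

Variable H : V -> int.
Hypothesis HE : forall g, g \in D -> 2 * pairing (rho Dp) g = (H g)%:~R.
Variable t : R.
Hypothesis t_gt0 : 0 < t.
Hypothesis t_lt1 : t < 1.

Let t0 : t != 0. Proof. exact: lt0r_neq0. Qed.

Local Notation q := (t^-1 - t).

(* After conjugation by [t ^ len] these weights tend, as [t] tends to 0, to the
   indicator function of the edges of the quantum Bruhat graph. *)
Definition wt (u : Mat) (b : V) : R :=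
  (1 - t ^+ 2) / (1 - t ^ H b) * (if u *m b \in Dp then t^-1 else t ^ (H b - 1)).

Fixpoint Z (s : seq V) (u v : Mat) : R :=
  if s is b :: s' then Z s' u v + wt u b * Z s' (u *m refl b) v else (u == v)%:R.

Lemma tH_lt1 b : b \in Dp -> 0 < t ^ H b < 1.
Proof.
move=> bP; rewrite exprz_gt0 //=; have := height_gt0 HD Dp_uniq f_neq0 Dp_def HE bP.
case: (H b) => // k; rewrite ltz_nat => k0.
by rewrite -exprnP exprn_ilt1 ?ltW // -lt0n.
Qed.

Lemma wt_ge0 u b : b \in Dp -> 0 <= wt u b.
Proof.
move=> /tH_lt1/andP[h0 h1]; have t2 : t ^+ 2 <= 1 by rewrite exprn_ile1 ?ltW.
rewrite /wt mulr_ge0 ?divr_ge0 ?subr_ge0 ?(ltW h1) //.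
by case: ifP => _; rewrite ?invr_ge0 ?exprz_ge0 // ltW.
Qed.

(** The two values of the weight differ by an amount independent of [b], the Hecke parameter; this
    explains the factor [(1 - t ^+ 2) / (1 - t ^ H b)]. *)
Lemma wt_diff b : b \in Dp ->
  (1 - t ^+ 2) / (1 - t ^ H b) * t^-1 - (1 - t ^+ 2) / (1 - t ^ H b) * t ^ (H b - 1) = q.
Proof.
move=> /tH_lt1/andP[_ h1]; rewrite expfzDr // exprN1.
have : 1 - t ^ H b != 0 by rewrite subr_eq0 gt_eqF.
by move: (t ^ H b) => h h'; field; rewrite h' t0.
Qed.

(** What makes left multiplication by [refl d] compatible with [Z]. In both instances [d] is the
    finite part of a simple affine root and [c] the twist demanded by its affine part: 1 for a
    simple root, a power of [t] for [- th]. The second and third clauses treat steps away from and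
    along the wall of [d]. *)
Definition twisted_move (d : V) (c : Mat -> R) : Prop :=
  [/\ d \in D,
      forall u b, W u -> b \in Dp -> u *m b != d -> u *m b != - d ->
        c u * wt (refl d *m u) b = wt u b * c (u *m refl b),
      forall u b, W u -> b \in Dp -> u *m b = d ->
        c u * wt (u *m refl b) b + q = wt u b * c (u *m refl b),
      forall u, W u -> u^T *m d \in Dp ->
        t ^+ len (refl d *m u) * c u = t * t ^+ len u &
      forall u, W u -> c (refl d *m u) * c u = 1].

Lemma simple_move a : simple Dp a -> twisted_move a (fun=> 1).
Proof.
move=> sa; have aP := simple_pos sa; have aD := PD aP; split=> //.
- move=> u b Wu bP nb nbN; rewrite mulr1 mul1r /wt -mulmxA; congr (_ * _).
  have ubD := Wr Wu (PD bP).
  have [ubP|ubN] := boolP (u *m b \in Dp); first by rewrite (simpleP sa).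
  have : refl a *m (- (u *m b)) \in Dp.
    by rewrite (simpleP sa) ?PN // eqr_oppLR.
  by rewrite mulmxN PN ?Drefl // => /negPf ->.
- move=> u b Wu bP ub; have bD := PD bP.
  have ubN : u *m refl b *m b \notin Dp.
    by rewrite -mulmxA refl_id ?D0 // mulmxN ub PN // aP.
  rewrite mul1r mulr1 /wt ub aP (negPf ubN) -(wt_diff bP); ring.
- move=> u Wu uaP; rewrite mulr1 -exprS; congr (_ ^+ _).
  exact: (len_simple HD Dp_uniq f_neq0 Dp_def).
- by move=> u _; rewrite mulr1.
Qed.

(** Where the two weights differ, they do so by a factor [t ^ H b], and the step along [b] changes
    the height of [u^T *m (- th)] by [H b] up to sign; the two effects cancel. *)
Lemma theta_move th : quasi_minuscule Dp th ->
  twisted_move (- th) (fun u => t ^ H (u^T *m (- th))).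
Proof.
move=> qth; have thP := qth.1; have thD := PD thP; split=> //; first by rewrite DN.
- move=> u b Wu bP nb; rewrite opprK => nbN; have bD := PD bP.
  have xD : u^T *m - th \in D by rewrite Wr ?DN //; apply: W_tr.
  have ubD := Wr Wu bD; have [k Ek] := root_int HD xD bD.
  have Ek' : pairing (u *m b) th = - k%:~R.
    rewrite -Ek -[in LHS](mulKT HD th Wu) (pairing_orth _ _ (W_orth HD Wu)).
    by rewrite mulmxN pairingNr opprK.
  rewrite reflN trmx_mul trmx_refl -[in RHS](mulmxA (refl b)) (height_refl HD HE bD xD Ek).
  have rW : forall y z : int, y = z -> t ^ y = t ^ z :> R by move=> y z ->.
  have [E|[E h1 h2]|[E h1 h2]] := theta_cases HD f_neq0 Dp_def qth ubD nbN nb.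
  + have k0 : k = 0 by apply: (@intr_inj R); apply: oppr_inj; rewrite -Ek' E oppr0.
    by rewrite k0 mul0r subr0 /wt -mulmxA mul_refl E scale0r subr0 mulrC.
  + have k1 : k = -1 by apply: (@intr_inj R); apply: oppr_inj; rewrite -Ek' E rmorphN opprK.
    rewrite k1 mulN1r opprK /wt -mulmxA h1 (negPf h2).
    set A := (1 - t ^+ 2) / _; rewrite mulrCA -[RHS]mulrA; congr (_ * _).
    by rewrite -exprN1 -!expfzDr //; apply: rW; clear; lia.
  + have k1 : k = 1 by apply: (@intr_inj R); apply: oppr_inj; rewrite -Ek' E.
    rewrite k1 mul1r /wt -mulmxA h2 (negPf h1).
    set A := (1 - t ^+ 2) / _; rewrite mulrCA -[RHS]mulrA; congr (_ * _).
    by rewrite -exprN1 -!expfzDr //; apply: rW; clear; lia.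
- move=> u b Wu bP ub; have bD := PD bP.
  have ubP : u *m refl b *m b \in Dp.
    by rewrite -mulmxA refl_id ?D0 // mulmxN ub opprK.
  rewrite trmx_mul trmx_refl -mulmxA -ub (mulTK HD) // refl_id ?D0 // (heightN HD HE) //.
  have ubN : u *m b \notin Dp by rewrite ub PN // thP.
  rewrite /wt ubP (negPf ubN) -(wt_diff bP) expfzDr // exprN1 -invr_expz.
  have : t ^ H b != 0 by rewrite expfz_neq0.
  by move: (t ^ H b) ((1 - t ^+ 2) / _) => h A h0; field; rewrite h0 t0.
- move=> u Wu uP; rewrite reflN.
  have := len_theta HD Dp_uniq f_neq0 Dp_def HE qth Wu uP.
  by move=> E; rewrite exprnP -expfzDr // E -exprnP exprS.
- move=> u Wu; rewrite -expfzDr // reflN trmx_mul trmx_refl -mulmxA mulmxN.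
  rewrite refl_id ?D0 // opprK mulmxN (heightN HD HE) ?addrN ?expr0z //.
  by rewrite Wr //; apply: W_tr.
Qed.

Local Lemma cat_rcons_eq S b rest : L = S ++ b :: rest -> L = rcons S b ++ rest.
Proof. by rewrite cat_rcons. Qed.

(** The Hecke relation for a suffix of [L]. The [flipped] bits tell on which side of the wall of [d]
    the initial and final chambers lie; allowing every prefix [S] lets the induction carry the
    initial bit along. *)
Lemma transfer_comm d c rest S u v : twisted_move d c -> L = S ++ rest -> W u -> W v ->
  c u * Z rest (refl d *m u) v + q * (flipped S (u^T *m d))%:R * Z rest u v =
  c (refl d *m v) * Z rest u (refl d *m v) + q * (flipped L (v^T *m d))%:R * Z rest u v.
Proof.
case=> dD mv1 mv2 _ mv4; elim: rest S u => [|b rest IH] S u EL Wu Wv /=.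
  rewrite cats0 in EL; have E : (refl d *m u == v) = (u == refl d *m v).
    apply/eqP/eqP => [<-|->]; by rewrite mulmxA refl_sqr ?D0 // mul1mx.
  rewrite E EL; congr (_ + _); last by case: eqP => [->|]; rewrite ?mulr0.
  by case: eqP => [->|]; rewrite ?mulr0.
have bp := next_pos EL; have bD := PD bp; have sD := flipped_step EL;
  have sc := @flipped_rcons S b.
have sb := flipped_rcons_b EL; have fb := flipped_b EL.
have {}EL := cat_rcons_eq EL.
have IHu := IH _ u EL Wu Wv.
have IHs := IH _ (u *m refl b) EL (W_reflr Wu bD) Wv.
have xD : u^T *m d \in D by rewrite Wr //; apply: W_tr.
have ux : u *m (u^T *m d) = d by rewrite (mulKT HD).
rewrite trmx_mul trmx_refl -mulmxA (sD _ xD) in IHs.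
rewrite !mulrDr [RHS]addrACA -IHu.
have -> : c (refl d *m v) * (wt u b * Z rest (u *m refl b) (refl d *m v)) +
   q * (flipped L (v^T *m d))%:R * (wt u b * Z rest (u *m refl b) v) =
  wt u b * (c (u *m refl b) * Z rest (refl d *m (u *m refl b)) v +
      q * (flipped S (u^T *m d))%:R * Z rest (u *m refl b) v) by rewrite IHs; ring.
(* If [u] sends [b] to [d] or [- d], left multiplication by [refl d] is the step along [b] itself,
   and the third clause of [twisted_move] accounts for the term in [q]. *)
have [E|nb] := eqVneq (u^T *m d) b; last have [E|nbN] := eqVneq (u^T *m d) (- b).
- have ub : u *m b = d by rewrite -E ux.
  have su : refl d *m u = u *m refl b by rewrite refl_conj ?(W_orth HD) // ub.
  rewrite E fb sb !su mulmxA su -mulmxA refl_sqr ?D0 // mulmx1.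
  have := mv2 u b Wu bp ub; move: (wt u b) (wt (u *m refl b) b) => w w' h.
  have -> : q = w * c (u *m refl b) - c u * w' by rewrite -h [RHS]addrAC subrr add0r.
  by rewrite /=; ring.
- have ub : u *m b = - d by rewrite -[b]opprK -E mulmxN ux.
  have su : refl d *m u = u *m refl b by rewrite refl_conj ?(W_orth HD) // ub reflN.
  have sub : u *m refl b *m b = d by rewrite -mulmxA refl_id ?D0 // mulmxN ub opprK.
  have nfb : flipped S (- b) = false by rewrite flippedN // fb.
  have nsb : flipped (rcons S b) (- b) = true by rewrite flippedN // sb.
  rewrite E nfb nsb !su mulmxA su -mulmxA refl_sqr ?D0 // mulmx1.
  have := mv2 (u *m refl b) b (W_reflr Wu bD) bp sub.
  rewrite -mulmxA refl_sqr ?D0 // mulmx1.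
  move: (wt u b) (wt (u *m refl b) b) => w w' h.
  have -> : q = w' * c u - c (u *m refl b) * w by rewrite -h [RHS]addrAC subrr add0r.
  by rewrite /=; ring.
rewrite (sc _ xD nb nbN) mulmxA.
have e1 : u *m b != d by apply: contraNneq nb => <-; rewrite (mulTK HD).
have e2 : u *m b != - d by apply: contraNneq nbN => E; rewrite -[d]opprK -E mulmxN (mulTK HD).
have := mv1 u b Wu bp e1 e2; rewrite [wt u b * (_ + _)]mulrDr [wt u b * (c _ * _)]mulrA => <-.
by ring.
Qed.

(** The case of the empty prefix, at [refl d *m v]. Over the whole of [L] every sign is flipped,
    which undoes the sign brought in by [refl d]. *)
Lemma transfer_rel d c u v : twisted_move d c -> W u -> W v ->
  c u * Z L (refl d *m u) (refl d *m v) + q * (u^T *m d \in Dp)%:R * Z L u (refl d *m v) =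
  c v * Z L u v + q * (v^T *m d \in Dp)%:R * Z L u (refl d *m v).
Proof.
move=> mv Wu Wv; have dD : d \in D by case: mv.
have := @transfer_comm d c L [::] u (refl d *m v) mv erefl Wu (W_refll Wv dD).
rewrite (mulmxA (refl d)) refl_sqr ?D0 // mul1mx.
have xD : v^T *m d \in D by rewrite Wr //; apply: W_tr.
rewrite trmx_mul trmx_refl -mulmxA refl_id ?D0 // mulmxN /flipped /= addbF opprK !memL PN //.
by rewrite orNb addbT negbK.
Qed.

(* [Z rest u v] sums over galleries from [u Delta_S] to [v Delta_L]; a step
   which folds does not move the chamber, so that a pair of opposite chambers
   can only be joined by a gallery without folds. *)
Local Definition crossed S (u u0 : Mat) : nat :=
  count (fun g => ~~ flipped S (u^T *m (u0 *m g))) Dp.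

Local Lemma crossed_stay S b rest u u0 : L = S ++ b :: rest -> W u -> W u0 ->
  (crossed (rcons S b) u u0 <= (crossed S u u0).+1)%N.
Proof.
move=> EL Wu Wu0; have bD : b \in D by rewrite PD ?(next_pos EL).
(* The only root that skipping [b] can newly count, since only the signs of [b] and [- b] change. *)
pose y := u0^T *m (u *m b).
apply: (@leq_trans (count (predU (fun g => ~~ flipped S (u^T *m (u0 *m g))) (pred1 y)) Dp)).
  apply: sub_count => g /=.
  have [gD|gN] := boolP (u^T *m (u0 *m g) \in D); last first.
    move=> _; apply/orP; left; apply: contraNN gN.
    rewrite /flipped; case: (boolP (_ \in Dp)) => [/PD //|_ /=].
    by move=> /orP[] /(subS EL)/PD; rewrite ?DN.
  have [E|nb] := eqVneq (u^T *m (u0 *m g)) b.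
    by move=> _; apply/orP; right; rewrite /y -E (mulKT HD) // (mulTK HD).
  have [->|nbN] := eqVneq (u^T *m (u0 *m g)) (- b).
    by rewrite !flippedN // (flipped_rcons_b EL) (flipped_b EL).
  by rewrite flipped_rcons // => ->.
have := count_predUI (fun g => ~~ flipped S (u^T *m (u0 *m g))) (pred1 y) Dp.
have := count_uniq_mem y Dp_uniq; rewrite /crossed; have := leq_b1 (y \in Dp).
by move: (count _ _) (count _ _) (count _ _) (count _ _); clear; lia.
Qed.

Local Lemma crossed_fold S b rest u u0 : L = S ++ b :: rest -> W u -> W u0 ->
  crossed (rcons S b) (u *m refl b) u0 = crossed S u u0.
Proof.
move=> EL Wu Wu0; apply: eq_in_count => g gP.
rewrite trmx_mul trmx_refl -(mulmxA (refl b)) (flipped_step EL) //.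
by rewrite Wr ?Wr ?PD //; apply: W_tr.
Qed.

(** Ending at [v] requires [crossed] to count all positive roots, while each entry of [L] adds at
    most one; a gallery behind its prefix never catches up. *)
Lemma no_gallery rest S u v u0 : L = S ++ rest -> W u -> W u0 ->
  (forall g, g \in Dp -> v^T *m (u0 *m g) \in Dp) ->
  (crossed S u u0 < size S)%N -> Z rest u v = 0.
Proof.
move=> + + Wu0 hv; elim: rest S u => [|b rest IH] S u EL Wu lt /=.
  rewrite cats0 in EL; case: eqP => // uv; move: lt; rewrite uv /crossed -EL.
  have -> : size L = size Dp by case: HL => /perm_size.
  rewrite (eq_in_count (a2 := predT)) ?count_predT ?ltnn // => g gP.
  by rewrite /flipped hv // memL hv.
have bD : b \in D by rewrite PD ?(next_pos EL).
have h1 := crossed_stay EL Wu Wu0; have h2 := crossed_fold EL Wu Wu0.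
have EL' := cat_rcons_eq EL.
rewrite (IH _ _ EL' Wu) ?(IH _ _ EL' (W_reflr Wu bD)) ?mulr0 ?addr0 // size_rcons.
  by rewrite h2 ltnS ltnW.
by apply: leq_ltn_trans h1 _.
Qed.

(** Taking any step puts the gallery behind its prefix and contributes 0 by [no_gallery], so only
    the empty sequence of steps can count. *)
Lemma gallery_le1 rest S u v u0 : L = S ++ rest -> W u -> W u0 ->
  (forall g, g \in Dp -> v^T *m (u0 *m g) \in Dp) ->
  (crossed S u u0 <= size S)%N -> Z rest u v <= 1.
Proof.
move=> + + Wu0 hv; elim: rest S u => [|b rest IH] S u EL Wu le /=.
  by case: (u == v).
have bD : b \in D by rewrite PD ?(next_pos EL).
have h1 := crossed_stay EL Wu Wu0; have h2 := crossed_fold EL Wu Wu0.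
have EL' := cat_rcons_eq EL.
rewrite (@no_gallery rest (rcons S b) (u *m refl b) v u0) ?mulr0 ?addr0 //.
- by apply: (IH (rcons S b)) => //; rewrite size_rcons; apply: leq_trans h1 _.
- exact: W_reflr.
- by rewrite h2 size_rcons.
Qed.

Definition Zn (u v : Mat) : R := t ^+ len v / t ^+ len u * Z L u v.

(** A [g] of length 0 permutes the positive roots. Hence [u] and [u *m g] have equal lengths, and
    [gallery_le1] applies with [u0] equal to [u]. *)
Lemma Zn_base u g : W u -> W g -> len g = 0%N -> Zn u (u *m g) <= 1.
Proof.
move=> Wu Wg g0.
have gP a : a \in Dp -> g *m a \in Dp.
  move=> aP; apply: contraT; rewrite -PN ?Wr ?PD // => h.
  have : has (fun b => - (g *m b) \in Dp) Dp by apply/hasP; exists a.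
  by rewrite has_count; move: g0; rewrite /wlength => ->.
have gTP a : a \in Dp -> g^T *m a \in Dp.
  move=> aP; have xD : g^T *m a \in D by rewrite Wr ?PD //; apply: W_tr.
  apply: contraT; rewrite -PN // => /gP; rewrite mulmxN (mulKT HD) // PN ?PD //.
  by rewrite aP.
have -> : Zn u (u *m g) = Z L u (u *m g).
  rewrite /Zn; suff -> : len (u *m g) = len u by rewrite divff ?mul1r ?expf_neq0.
  have pg : perm_eq [seq g *m a | a <- Dp] Dp.
    apply: uniq_perm => //.
      by rewrite map_inj_uniq // => x y E; rewrite -(mulTK HD x Wg) E (mulTK HD).
    move=> x; apply/mapP/idP => [[a aP ->]|xP]; first exact: gP.
    by exists (g^T *m x); rewrite ?gTP ?(mulKT HD).
  rewrite /wlength -(permP pg (fun a => - (u *m a) \in Dp)) count_map.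
  by apply: eq_count => a /=; rewrite mulmxA.
apply: (@gallery_le1 L [::] u (u *m g) u) => //.
  by move=> a aP; rewrite trmx_mul -mulmxA (mulTK HD) // gTP.
rewrite /crossed (eq_in_count (a2 := pred0)) ?count_pred0 // => a aP.
by rewrite (mulTK HD) // /flipped aP.
Qed.

(** * Moves acting on the normalized sums *)

Section Move.
Variables (d : V) (c : Mat -> R).
Hypothesis mv : twisted_move d c.

Local Lemma move_up u : W u -> u^T *m d \in Dp ->
  c u = t * t ^+ len u / t ^+ len (refl d *m u).
Proof.
by case: mv => _ _ _ h _ Wu uP; rewrite -h // mulrC mulKf // expf_neq0.
Qed.

Local Lemma move_down u : W u -> u^T *m d \notin Dp ->
  c u = t ^+ len u / (t * t ^+ len (refl d *m u)).
Proof.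
case: mv => dD _ _ h h' Wu uN; have sW := W_refll Wu dD.
have ssu : refl d *m (refl d *m u) = u by rewrite mulmxA refl_sqr ?D0 // mul1mx.
have uD : u^T *m d \in D by rewrite Wr //; apply: W_tr.
have := h _ sW; rewrite ssu trmx_mul trmx_refl -mulmxA refl_id ?D0 // mulmxN PN //.
move=> /(_ uN) <-.
have := h' u Wu; move: (c _) (c u) => x y xy.
have x0 : x != 0 by apply: contra_eq_neq xy => ->; rewrite mul0r eq_sym oner_eq0.
have : t ^+ len u != 0 by rewrite expf_neq0.
by move: (t ^+ len u) => a a0; apply: (mulfI x0); rewrite xy; field; rewrite x0 a0.
Qed.

(** The two terms in [q] of [transfer_rel] coincide and cancel; the twist [c] is absorbed by the
    change of length. *)
Lemma Zn_same u v : W u -> W v -> (u^T *m d \in Dp) = (v^T *m d \in Dp) ->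
  Zn (refl d *m u) (refl d *m v) = Zn u v.
Proof.
move=> Wu Wv uv; have := transfer_rel mv Wu Wv; rewrite uv => /addIr; rewrite /Zn.
have T k : t ^+ k != 0 by rewrite expf_neq0.
have [vP|vN] := boolP (v^T *m d \in Dp).
  rewrite !move_up ?uv //; move: (T (len u)) (T (len v)) (T (len (refl d *m u))) (T (len
    (refl d *m v))).
  move: (t ^+ len u) (t ^+ len v) (t ^+ len (refl d *m u)) (t ^+ len (refl d *m v)).
  move: (Z L u v) (Z L _ _) => Y X a b a' b' a0 b0 a0' b0' h.
  have -> : b / a * Y = b' / (t * a) * (t * b / b' * Y) by field; rewrite a0 b0' t0.
  by rewrite -h; field; rewrite a0 a0' t0.
rewrite !move_down ?uv //; move: (T (len u)) (T (len v)) (T (len (refl d *m u))) (T (len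
  (refl d *m v))).
move: (t ^+ len u) (t ^+ len v) (t ^+ len (refl d *m u)) (t ^+ len (refl d *m v)).
move: (Z L u v) (Z L _ _) => Y X a b a' b' a0 b0 a0' b0' h.
have -> : b / a * Y = t * b' / a * (b / (t * b') * Y) by field; rewrite a0 b0' t0.
by rewrite -h; field; rewrite a0 a0' t0.
Qed.

(** Only one term in [q] survives; after normalization its coefficient is [t * q], that is
    [1 - t ^+ 2]. *)
Lemma Zn_up_down u v : W u -> W v -> u^T *m d \in Dp -> v^T *m d \notin Dp ->
  Zn u v = t ^+ 2 * Zn (refl d *m u) (refl d *m v) + (1 - t ^+ 2) * Zn u (refl d *m v).
Proof.
move=> Wu Wv uP vN; have := transfer_rel mv Wu Wv; rewrite uP (negPf vN) /Zn.
have T k : t ^+ k != 0 by rewrite expf_neq0.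
rewrite (move_up Wu uP) (move_down Wv vN) mulr1 mulr0 mul0r addr0.
move: (T (len u)) (T (len v)) (T (len (refl d *m u))) (T (len (refl d *m v))).
move: (t ^+ len u) (t ^+ len v) (t ^+ len (refl d *m u)) (t ^+ len (refl d *m v)).
move: (Z L u v) (Z L u _) (Z L _ _) => Y U X a b a' b' a0 b0 a0' b0' h.
have -> : b / a * Y = t * b' / a * (b / (t * b') * Y) by field; rewrite a0 b0' t0.
by rewrite -h; field; rewrite a0 a0' t0.
Qed.

End Move.

(* If the maximal value of [v |-> Zn (v g^-1) v] exceeds 1, the set of maximizers
   is stable under all moves with [v^-1 d < 0], hence, summing the vectors [v f]
   over it, under all simple reflections; but at a suitable [v] in it
   [Zn_up_down] is a proper convex combination involving a shorter [g]. *)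
Theorem Zn_le1 u g : W u -> W g -> Zn u (u *m g) <= 1.
Proof.
have [m] := ubnP (len g); elim: m g u => // m IH g u gm Wu Wg.
have [g0|gn0] := posnP (len g); first exact: Zn_base.
have [Ws [Ws_uniq memWs]] := W_finite HD.
have Wmem v : W v -> v \in Ws by move/memWs.
have Wmem' v : v \in Ws -> W v by move/memWs.
pose F v := Zn (v *m g^T) v.
have [v0 [Wv0 _ v0max]] : exists v0, [/\ v0 \in Ws, True & forall v, v \in Ws -> True ->
  F v <= F v0].
  by apply: (argmax_seq F); exists u => //; apply: Wmem.
have Fu : Zn u (u *m g) = F (u *m g) by rewrite /F -mulmxA (W_orthr HD) ?mulmx1.
have Wug : u *m g \in Ws by apply/Wmem/W_mul.
rewrite Fu; have [F1|F1] := leP (F v0) 1; first exact: le_trans (v0max _ Wug I) F1.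
exfalso; pose S v := F v == F v0.
have Wu' v : W v -> W (v *m g^T) by move=> Wv; apply: W_mul => //; apply: W_tr.
have gT v x : (v *m g^T)^T *m x = g *m (v^T *m x) by rewrite trmx_mul trmxK mulmxA.
have t2 : 0 < 1 - t ^+ 2 by rewrite subr_gt0 exprn_ilt1 // ltW.
(* Otherwise [Zn_up_down] expresses the maximum through a value not above it and, with positive
   coefficient, a value at most 1 by induction, because [g *m refl (- (v^T *m d))] is shorter than
   [g]. *)
have no_up d c v : twisted_move d c -> W v -> S v -> v^T *m d \notin Dp ->
    (v *m g^T)^T *m d \notin Dp.
  move=> mv Wv /eqP Sv vN; apply/negP => uP; have dD : d \in D by case: mv.
  have xD : v^T *m d \in D by rewrite Wr //; apply: W_tr.
  have bP : - (v^T *m d) \in Dp by rewrite PN.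
  have := Zn_up_down mv (Wu' _ Wv) Wv uP vN; rewrite -/(F v) Sv.
  have -> : Zn (refl d *m (v *m g^T)) (refl d *m v) = F (refl d *m v) by rewrite /F mulmxA.
  have le1 : F (refl d *m v) <= F v0 by apply: v0max => //; apply/Wmem/W_refll.
  have E : refl d *m v = v *m g^T *m (g *m refl (- (v^T *m d))).
    rewrite -!mulmxA (mulmxA g^T) (W_orth HD) // mul1mx refl_conj ?(W_orth HD) //.
    by rewrite mulmxN (mulKT HD) // reflN.
  have le2 : Zn (v *m g^T) (refl d *m v) <= 1.
    rewrite E; apply: IH => //; [|exact: Wu'|exact: W_reflr (PD bP)].
    have := @len_refl_lt _ _ D Dp f HD Dp_uniq f_neq0 Dp_def g (- (v^T *m d)) Wg bP.
    rewrite mulmxN -gT PN; last by rewrite Wr //; apply/W_tr/Wu'.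
    by rewrite uP => /(_ isT) h; apply: leq_trans h _.
  by apply: convex_lt F1 le1 le2; rewrite ?exprn_ge0 ?ltW // -subr_gt0.
have down d c v : twisted_move d c -> W v -> S v -> v^T *m d \notin Dp -> S (refl d *m v).
  move=> mv Wv Sv vN; have uN := no_up d c v mv Wv Sv vN.
  rewrite /S -(eqP Sv) /F -mulmxA; apply/eqP.
  by apply: (Zn_same mv) => //; [exact: Wu'|rewrite (negPf vN) (negPf uN)].
pose Y : V := \sum_(v <- Ws) (S v)%:R *: (v *m f).
have dotY x : dot Y x = \sum_(v <- Ws) (S v)%:R * dot f (v^T *m x).
  by rewrite dot_suml; apply: eq_bigr => v _; rewrite dotZl dotM.
(* When [v] is paired with [refl d *m v], [down] makes every term nonnegative, so a zero sum forces
   each term to vanish. *)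
have key d c : twisted_move d c -> 0 <= dot Y d /\
    (dot Y d = 0 -> forall v, W v -> S v = S (refl d *m v)).
  move=> mv; have dD : d \in D by case: mv.
  have term v : v \in Ws -> 0 <= ((S v)%:R - (S (refl d *m v))%:R) * dot f (v^T *m d).
    move=> /Wmem' Wv; have xD : v^T *m d \in D by rewrite Wr //; apply: W_tr.
    have svN : (refl d *m v)^T *m d = - (v^T *m d).
      by rewrite trmx_mul trmx_refl -mulmxA refl_id ?D0 // mulmxN.
    have ssv : refl d *m (refl d *m v) = v by rewrite mulmxA refl_sqr ?D0 // mul1mx.
    have [vP|vN] := boolP (v^T *m d \in Dp).
      have := down d c (refl d *m v) mv (W_refll Wv dD); rewrite svN PN // negbK ssv.
      have := pos_gt0 Dp_def vP; case: (S v); case: (S _);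
        rewrite ?subrr ?subr0 ?mul0r ?mul1r //.
        by move/ltW.
      by move=> _ h; have := h isT vP.
    have : - (v^T *m d) \in Dp by rewrite PN.
    move/(pos_gt0 Dp_def); rewrite dotNr oppr_gt0 => lt0; have := down d c v mv Wv.
    case: (S v); case: (S _); rewrite ?subrr ?sub0r ?subr0 ?mul0r ?mul1r ?mulN1r ?oppr_ge0
      ?(ltW lt0) //.
    by move=> h; have := h isT vN.
  have E : 2 * dot Y d = \sum_(v <- Ws) ((S v)%:R - (S (refl d *m v))%:R) * dot f (v^T *m d).
    rewrite dotY; apply: (@sum_involution _ _ _ (fun v => refl d *m v) S) => //.
    - by move=> v /Wmem' Wv; apply/Wmem/W_refll.
    - by move=> v _; rewrite mulmxA refl_sqr ?D0 // mul1mx.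
    - by move=> v _; rewrite trmx_mul trmx_refl -mulmxA refl_id ?D0 // mulmxN dotNr.
  split.
    by rewrite -(pmulr_rge0 _ (ltr0Sn R 1)) E big_seq sumr_ge0.
  move=> Y0; move: E; rewrite Y0 mulr0 big_seq => /esym/eqP.
  rewrite psumr_eq0 // => /allP h v Wv; have := h v (Wmem v Wv).
  rewrite Wmem //= mulf_eq0 subr_eq0 (negPf (f_neq0 _)) ?orbF.
    by rewrite eqr_nat; case: (S v); case: (S _).
  by rewrite Wr //; apply: W_tr.
(* [Y] pairs nonnegatively with the simple roots and with [- th], while [th] dominates [a]; hence
   [dot Y a = 0]. *)
have Sclosed v a : simple Dp a -> W v /\ S v -> W (refl a *m v) /\ S (refl a *m v).
  move=> sa [Wv Sv]; have aP := simple_pos sa; split; first by apply: W_refll => //; apply: PD.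
  have [th [thP thmax qth]] := highest_root HD f_neq0 Dp_def sa.
  have [th0 _] := key _ _ (theta_move (conj thP qth)).
  have ya : dot Y a <= dot Y th.
    by apply: thmax => b sb; have [] := key _ _ (simple_move sb).
  have [a0 h] := key _ _ (simple_move sa).
  rewrite -h //; apply/eqP; rewrite eq_le a0 andbT (le_trans ya) //.
  by move: th0; rewrite dotNr oppr_ge0.
(* [b] is an inversion of [g]. A maximizer [v] with [v *m b = - a] and [a] simple is lowered by [a],
   while [v *m g^T] is raised, contrary to [no_up]. *)
have [b bP gbN] : exists2 b, b \in Dp & - (g *m b) \in Dp.
  by move: gn0; rewrite /wlength -has_count => /hasP.
have bD := PD bP.
have [v [Wv Sv] [a sa vb]] : exists2 v, W v /\ S v & exists2 a, simple Dp a & v *m b = - a.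
  have Sv0 : W v0 /\ S v0 by split; [exact: Wmem'|exact: eqxx].
  have vbD : v0 *m b \in D by rewrite Wr //; apply: Wmem'.
  have [vP|] := boolP (v0 *m b \in Dp).
    have [v Sv sv] := pos_to_simple HD f_neq0 Dp_def (S := fun v =>
      W v /\ S v) (fun v a sa => @Sclosed v a sa) Sv0 vP.
    exists (refl (v *m b) *m v); first exact: Sclosed.
    by exists (v *m b) => //; rewrite -mulmxA refl_id // D0 // PD // simple_pos.
  rewrite -PN // -mulmxN => vN.
  have [v Sv sv] := pos_to_simple HD f_neq0 Dp_def (S := fun v => W v /\ S v) (fun v a sa =>
    @Sclosed v a sa) Sv0 vN.
  by exists v => //; exists (v *m - b) => //; rewrite mulmxN opprK.
have aP := simple_pos sa.
have va : v^T *m a = - b by rewrite -[a]opprK -vb mulmxN (mulTK HD).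
have := no_up _ _ v (simple_move sa) Wv Sv; rewrite gT va PN // bP => /(_ isT).
by rewrite mulmxN gbN.
Qed.

End Transfer.

(** * Uniqueness of monotone paths in the quantum Bruhat graph *)

Lemma cancel_fraction (R : realFieldType) (x y z w r : R) :
  x != 0 -> z != 0 -> y / x * (w * r) = z / x * w * (y / z * r).
Proof. by move=> x0 z0; field; rewrite x0 z0. Qed.

Section Count.
Variables (R : realFieldType) (n : nat).
Notation V := 'cV[R]_n.
Notation Mat := 'M[R]_n.
Variables (D Dp : seq V).

Local Notation W := (inW D).
Local Notation len := (wlength Dp).

Fixpoint qbg_path (u : Mat) (p : seq V) (v : Mat) : Prop :=
  if p is b :: p' then qbg_edge Dp u b (u *m refl b) /\ qbg_path (u *m refl b) p' v
  else u = v.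

Lemma qbg_path_cat u p1 p2 v :
  qbg_path u (p1 ++ p2) v <-> exists2 x, qbg_path u p1 x & qbg_path x p2 v.
Proof.
elim: p1 u => [|b p1 IH] u /=; first by split=> [h|[x ->]]; [exists u|].
split=> [[e /IH[x h1 h2]]|[x [e h1] h2]]; first by exists x.
by split=> //; apply/IH; exists x.
Qed.

Definition edgeb (u : Mat) (b : V) : bool :=
  (b \in Dp) && ((len (u *m refl b) == (len u).+1) ||
    ((len (u *m refl b))%:R == (len u)%:R - 2 * pairing (rho Dp) b + 1 :> R)).

Lemma edgeP u b : reflect (qbg_edge Dp u b (u *m refl b)) (edgeb u b).
Proof.
apply: (iffP andP) => [[bP /orP h]|[bP _ h]]; split=> //.
  by case: h => /eqP ->; [left|right].
by apply/orP; case: h => ->; [left|right].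
Qed.

(** The recursion of [Z] with each weight replaced by the indicator of an edge, so that the two
    compare term by term. *)
Fixpoint num_paths (s : seq V) (u v : Mat) : nat :=
  if s is b :: s' then
    (num_paths s' u v + (if edgeb u b then num_paths s' (u *m refl b) v else 0))%N
  else (u == v).

Lemma subseq_consP (T : eqType) (b : T) (p s : seq T) : subseq p (b :: s) ->
  subseq p s \/ exists2 p', p = b :: p' & subseq p' s.
Proof.
case: p => [|x p] /=; first by left; apply: sub0seq.
by case: eqP => [->|_]; [right; exists p | left].
Qed.

Lemma num_paths_gt0 s u p v : subseq p s -> qbg_path u p v -> (0 < num_paths s u v)%N.
Proof.
elim: s u p => [|b s IH] u p; first by rewrite subseq0 => /eqP -> /= ->; rewrite eqxx.
case/subseq_consP => [ps up|[p' -> ps]] /=; first by rewrite addn_gt0 (IH _ p).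
by move=> [/edgeP -> h]; rewrite addn_gt0 (IH _ p' ps h) orbT.
Qed.

Lemma num_paths_gt1 s u p p' v : subseq p s -> subseq p' s -> p != p' ->
  qbg_path u p v -> qbg_path u p' v -> (1 < num_paths s u v)%N.
Proof.
elim: s u p p' => [|b s IH] u p p'.
  by rewrite !subseq0 => /eqP-> /eqP->; rewrite eqxx.
case/subseq_consP => [ps|[r -> rs]]; case/subseq_consP => [ps'|[r' -> rs']] ne /= h h'.
- by apply: leq_trans (leq_addr _ _); apply: IH h h'.
- have [/edgeP -> h1'] := h'.
  by have := num_paths_gt0 ps h; have := num_paths_gt0 rs' h1'; clear; lia.
- have [/edgeP -> h1] := h.
  by have := num_paths_gt0 ps' h'; have := num_paths_gt0 rs h1; clear; lia.
have [/edgeP -> h1] := h; have [_ h1'] := h'.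
apply: leq_trans (leq_addl _ _); apply: IH h1 h1' => //.
by apply: contraNneq ne => ->.
Qed.

(** * Bounding the number of paths by the weighted sum *)

Section Bound.
Variables (f : V) (L : seq V) (H : V -> int) (t : R).
Hypothesis HD : simple_root_system D.
Hypothesis Dp_uniq : uniq Dp.
Hypothesis f_neq0 : forall a, a \in D -> dot f a != 0.
Hypothesis Dp_def : forall a, (a \in Dp) = (a \in D) && (0 < dot f a).
Hypothesis HE : forall g, g \in D -> 2 * pairing (rho Dp) g = (H g)%:~R.
Hypothesis t_gt0 : 0 < t.
Hypothesis t_lt1 : t < 1.

Let t0 : t != 0. Proof. exact: lt0r_neq0. Qed.

(** The sign of [u *m b] decides whether the length goes up or down, so a Bruhat edge carries [t^-1]
    and a quantum edge [t ^ (H b - 1)]; the powers of [t] cancel against the change of length. *)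
Lemma wt_edge u b : W u -> edgeb u b ->
  1 - t ^+ 2 <= t ^+ len (u *m refl b) / t ^+ len u * wt Dp H t u b.
Proof.
move=> Wu /andP[bP e]; have bD := posD Dp_def bP.
have H0 := height_gt0 HD Dp_uniq f_neq0 Dp_def HE bP.
have /andP[h0 h1] := tH_lt1 HD Dp_uniq f_neq0 Dp_def HE t_gt0 t_lt1 bP.
have t2 : 0 < 1 - t ^+ 2 by rewrite subr_gt0 exprn_ilt1 // ltW.
have A1 : 1 - t ^+ 2 <= (1 - t ^+ 2) / (1 - t ^ H b).
  rewrite ler_pdivlMr ?subr_gt0 //; have := mulr_gt0 t2 h0.
  by rewrite mulrBr mulr1; lra.
suff -> : t ^+ len (u *m refl b) / t ^+ len u * wt Dp H t u b = (1 - t ^+ 2) / (1 - t ^ H b)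
  by [].
rewrite /wt; move: ((1 - t ^+ 2) / _) => A; rewrite mulrCA -[RHS]mulr1; congr (_ * _).
have eZ : (len (u *m refl b) == (len u).+1) \/ ((len (u *m refl b))%:Z + H b == (len u)%:Z + 1).
  case/orP: e => [|/eqP e]; [by left|right]; apply/eqP/(@intr_inj R).
  by rewrite !rmorphD /= -!pmulrn e HE // addrAC subrK.
have Tk k : t ^+ k != 0 by rewrite expf_neq0.
case: ifP => [ubP|/negbT ubN].
  have := len_refl_gt HD Dp_uniq f_neq0 Dp_def Wu bP ubP.
  case: eZ => /eqP; last by move: H0; clear; lia.
  by move=> -> _; rewrite exprS; have := Tk (len u); move: (t ^+ _) => x x0; field;
    rewrite x0 t0.
have := len_refl_lt HD Dp_uniq f_neq0 Dp_def Wu bP ubN.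
case: eZ => /eqP; first by move=> ->; clear; lia.
move=> E _; rewrite !exprnP invr_expz -!expfzDr //.
by rewrite (_ : _ + _ = 0) ?expr0z //; move: E; clear; lia.
Qed.

Lemma num_paths_le s u v : {subset s <= Dp} -> W u ->
  (1 - t ^+ 2) ^+ size s * (num_paths s u v)%:R <=
  t ^+ len v / t ^+ len u * Z Dp H t s u v.
Proof.
have e0 : 0 <= 1 - t ^+ 2 by rewrite subr_ge0 exprn_ile1 // ltW.
have e1 : 1 - t ^+ 2 <= 1 by rewrite gerBl exprn_ge0 // ltW.
have r0 x y : 0 <= t ^+ len x / t ^+ len y.
  by rewrite divr_ge0 // exprn_ge0 // ltW.
elim: s u => [|b s IH] u sP Wu /=.
  by rewrite expr0 mul1r; case: eqP => [->|_]; rewrite ?mulr0 // mulr1 divff // expf_neq0.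
have bP : b \in Dp by rewrite sP ?mem_head.
have bD := posD Dp_def bP.
have sP' : {subset s <= Dp} by move=> x xs; rewrite sP // inE xs orbT.
have IHu := IH u sP' Wu; have IHs := IH _ sP' (W_reflr Wu bD).
have w0 := wt_ge0 HD Dp_uniq f_neq0 Dp_def HE t_gt0 t_lt1 u bP.
rewrite natrD mulrDr [leRHS]mulrDr; apply: lerD.
  apply: le_trans IHu; rewrite exprS -mulrA ler_piMl // mulr_ge0 // exprn_ge0 //.
have -> : t ^+ len v / t ^+ len u * (wt Dp H t u b * Z Dp H t s (u *m refl b) v) =
    (t ^+ len (u *m refl b) / t ^+ len u * wt Dp H t u b) *
    (t ^+ len v / t ^+ len (u *m refl b) * Z Dp H t s (u *m refl b) v).
  by apply: cancel_fraction; rewrite expf_neq0.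
have I0 : 0 <= (1 - t ^+ 2) ^+ size s * (num_paths s (u *m refl b) v)%:R.
  by rewrite mulr_ge0 // exprn_ge0.
case: ifP => [e|_].
  by rewrite exprS -mulrA ler_pM // wt_edge.
by rewrite mulr0 mulr_ge0 ?(le_trans I0 IHs) // mulr_ge0.
Qed.

End Bound.

Theorem qbg_path_uniq L u v p p' :
  simple_root_system D -> positive_system D Dp -> reflection_order Dp L -> W u -> W v ->
  subseq p L -> subseq p' L -> qbg_path u p v -> qbg_path u p' v -> p = p'.
Proof.
move=> HD [Dp_uniq [f [f_neq0 Dp_def]]] HL Wu Wv pL p'L up up'.
have [H HE] := exists_height HD Dp_def.
apply/eqP; apply: contraT => ne.
have np := num_paths_gt1 pL p'L ne up up'.
(* This [t] gives [k * t ^+ 2 <= k * t < 1 / 2], so by the Bernoulli inequality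
   [2 * (1 - t ^+ 2) ^+ size L] exceeds 1. *)
pose k : R := (size L)%:R; pose t : R := (2 * (k + 1))^-1.
have k0 : 0 <= k by rewrite /k.
have d0 : 0 < 2 * (k + 1) by lra.
have t_gt0 : 0 < t by rewrite /t invr_gt0.
have tE : 2 * (k + 1) * t = 1 by rewrite /t divff // gt_eqF.
have t_lt1 : t < 1 by rewrite /t invf_lt1 //; lra.
have LP : {subset L <= Dp} by move=> x; case: HL => /perm_mem ->.
have := num_paths_le HD Dp_uniq f_neq0 Dp_def HE t_gt0 t_lt1 v LP Wu.
have Wg : W (u^T *m v) by apply: W_mul => //; apply: W_tr.
have := Zn_le1 HD Dp_uniq f_neq0 Dp_def HL HE t_gt0 t_lt1 Wu Wg.
rewrite /Zn mulmxA (W_orthr HD Wu) mul1mx => h1 h2; have {h2 h1} := le_trans h2 h1.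
have bern j : 1 - j%:R * t ^+ 2 <= (1 - t ^+ 2) ^+ j.
  have e0 : 0 <= 1 - t ^+ 2 by rewrite subr_ge0 exprn_ile1 // ltW.
  elim: j => [|j IH]; first by rewrite mul0r subr0 expr0.
  rewrite [leRHS]exprS; apply: le_trans (ler_wpM2l e0 IH).
  rewrite -natr1; have := mulr_ge0 (ler0n R j) (sqr_ge0 (t ^+ 2)).
  by rewrite expr2 => h; move: (j%:R) (t ^+ 2) h => x y h; nra.
have := bern (size L); rewrite -/k.
have t2 : t ^+ 2 <= t by rewrite expr2 ler_piMl // ltW.
have kt := ler_wpM2l k0 t2.
have np' : 2 <= (num_paths L u v)%:R :> R by rewrite (ler_nat R 2).
have e0 : 0 <= (1 - t ^+ 2) ^+ size L.
  by rewrite exprn_ge0 // subr_ge0 exprn_ile1 // ltW.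
have := ler_wpM2l e0 np'.
by move: ((1 - t ^+ 2) ^+ _) => x; lra.
Qed.

End Count.

(** * Index sets and reflection orders *)

Lemma index_rev_uniq (T : eqType) (s : seq T) x : uniq s -> x \in s ->
  index x (rev s) = (size s - (index x s).+1)%N.
Proof.
move=> us xs; have xi : (index x s < size s)%N by rewrite index_mem.
set k := (size s - _)%N; have ks : (k < size s)%N by rewrite /k; move: xi; clear; lia.
have ki : (size s - k.+1 = index x s)%N by rewrite /k; move: xi; clear; lia.
have e : nth x (rev s) k = x by rewrite nth_rev // ki nth_index.
by rewrite -{1}e index_uniq ?rev_uniq ?size_rev.
Qed.

(** Labels along a block of the chain decrease, whereas [qbg_path_uniq] reads paths along the
    order. *)
Lemma reflection_order_rev (R : realFieldType) (n : nat) (Dp ord : seq 'cV[R]_n) :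
  uniq Dp -> reflection_order Dp ord -> reflection_order Dp (rev ord).
Proof.
move=> Dp_uniq [pe h]; split; first by rewrite perm_rev.
have uo : uniq ord by rewrite (perm_uniq pe).
have flip x y : x \in Dp -> y \in Dp -> olt ord y x -> olt (rev ord) x y.
  rewrite -!(perm_mem pe) /olt => xo yo; rewrite !index_rev_uniq //.
  by move: xo; rewrite -index_mem; clear; lia.
move=> a b aP bP abP.
by case/orP: (h a b aP bP abP) => /andP[h1 h2]; apply/orP; [right|left]; rewrite !flip.
Qed.

Lemma sorted_olt (R : realFieldType) (n : nat) (ord : seq 'cV[R]_n) :
  uniq ord -> sorted (olt ord) ord.
Proof.
move=> uo; apply/(sortedP 0) => i io; rewrite /olt !index_uniq //.
exact: ltn_trans io.
Qed.

Lemma decreasing_subseq (R : realFieldType) (n : nat) (ord p : seq 'cV[R]_n) :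
  uniq ord -> {subset p <= ord} -> sorted (fun x y => olt ord y x) p ->
  subseq p (rev ord).
Proof.
move=> uo po sp; pose r := fun x y => olt ord y x.
have rtr : transitive r by move=> y x z; rewrite /r /olt => h1 h2; apply: ltn_trans h1.
have rirr : irreflexive r by move=> x; rewrite /r /olt ltnn.
suff -> : p = filter (mem p) (rev ord) by apply: filter_subseq.
apply: (irr_sorted_eq rtr rirr) => //.
  by apply: sorted_filter => //; rewrite rev_sorted; apply: sorted_olt.
by move=> x; rewrite mem_filter mem_rev /=; apply/idP/andP => [h|[]//]; rewrite po.
Qed.

(** On a strictly increasing [A], such a predicate selects an initial segment, so that a count in
    [Xi] designates a vertex of the path. *)
Definition down_closed (P : pred nat) (A : seq nat) : Prop :=
  forall i j, i \in A -> j \in A -> (i < j)%N -> P j -> P i.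

Lemma down_closed_cat P A : sorted ltn A -> down_closed P A ->
  A = filter P A ++ filter (predC P) A.
Proof.
elim: A => //= j A IH sA dc; have sA' := path_sorted sA.
have dc' : down_closed P A by move=> x y xA yA; apply: dc; rewrite inE ?xA ?yA orbT.
have [Pj|NPj] := boolP (P j); first by rewrite /= -IH.
have jA : {in A, forall i, (j < i)%N} by apply/allP; apply: (order_path_min ltn_trans sA).
have N i : i \in A -> ~~ P i.
  move=> iA; apply: contraNN NPj => Pi.
  by apply: dc (jA i iA) Pi; rewrite ?mem_head // inE iA orbT.
rewrite (eq_in_filter (a2 := pred0)) ?filter_pred0; last by move=> i /N/negPf.
by rewrite (eq_in_filter (a2 := predT)) ?filter_predT // => i /N.
Qed.

Lemma take_count P A : sorted ltn A -> down_closed P A -> take (count P A) A = filter P A.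
Proof.
move=> sA dc; rewrite {2}(down_closed_cat sA dc) -size_filter.
by rewrite take_size_cat.
Qed.

Lemma filter_between P Q A : sorted ltn A -> down_closed P A -> down_closed Q A ->
  {in A, subpred P Q} -> filter Q A = filter P A ++ filter (predD Q P) A.
Proof.
move=> sA dP dQ PQ.
have sQ : sorted ltn (filter Q A) by apply: (sorted_filter ltn_trans).
have dPQ : down_closed P (filter Q A).
  by move=> i j; rewrite !mem_filter => /andP[_ iA] /andP[_ jA]; apply: dP.
rewrite {1}(down_closed_cat sQ dPQ) -!filter_predI; congr (_ ++ _).
by apply: eq_in_filter => i iA /=; case: (boolP (P i)) => //= /(PQ i iA) ->.
Qed.

(** Puts the index [nn] of [Xi] in the form of a count of one predicate. *)
Lemma count_window (T : Type) (g : nat -> T) (N : pred T) P Q A :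
  sorted ltn A -> down_closed P A -> down_closed Q A -> {in A, subpred P Q} ->
  (count P A + count N (take (count Q A - count P A) (drop (count P A) [seq g j | j <- A])))%N =
  count (fun j => P j || Q j && N (g j)) A.
Proof.
move=> sA dP dQ PQ.
have le : (count P A <= count Q A)%N.
  by rewrite -!size_filter (filter_between sA dP dQ PQ) size_cat leq_addr.
rewrite -map_drop -map_take take_drop subnK // take_count //.
rewrite (filter_between sA dP dQ PQ) -size_filter drop_size_cat // count_map.
rewrite count_filter size_filter; elim: A PQ {sA dP dQ le} => //= j s IH PQ.
have /IH h : {in s, subpred P Q} by move=> i is_; apply: PQ; rewrite inE is_ orbT.
rewrite addnACA h; congr (_ + _)%N; rewrite /=.
by have := PQ j (mem_head _ _); case: (P j); case: (Q j); case: (N (g j)) => //= ->.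
Qed.

(** * Decoding Xi *)

Section Chain.
Variables (R : realFieldType) (n : nat).
Notation V := 'cV[R]_n.
Notation Mat := 'M[R]_n.
Variables (D Dp ord : seq V) (lam : V) (chain : seq (V * int)).
Hypothesis HD : simple_root_system D.
Hypothesis HDp : positive_system D Dp.
Hypothesis Hord : reflection_order Dp ord.
Hypothesis Hchain : is_lambda_chain D Dp ord lam chain.

Local Notation g := (gam chain).
Local Notation d := (dd lam chain).
Local Notation N := (size chain).

Lemma pos_sub_root a : a \in Dp -> a \in D.
Proof. by case: HDp => _ [f [_ h]]; rewrite h => /andP[]. Qed.

Lemma pos_opp a : a \in D -> a \notin Dp -> - a \in Dp.
Proof. by case: HDp => _ [f [h0 h]] aD; rewrite (posN HD h0 h). Qed.

Lemma olt_trans : transitive (olt ord).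
Proof. by move=> y x z; apply: ltn_trans. Qed.

Lemma aprec_trans : transitive (aprec Dp ord).
Proof.
move=> y x z; rewrite /aprec.
case: (x \in Dp); case: (y \in Dp); case: (z \in Dp) => //=; rewrite ?orbF.
  exact: olt_trans.
exact: olt_trans.
Qed.

Lemma invlt_trans : transitive (invlt Dp ord lam).
Proof.
move=> y x z /orP[xy|/andP[/eqP xy pxy]] /orP[yz|/andP[/eqP yz pyz]]; apply/orP.
- by left; apply: lt_trans xy yz.
- by left; rewrite -yz.
- by left; rewrite xy.
by right; rewrite xy yz eqxx; apply: aprec_trans pyz pxy.
Qed.

Lemma chain_lt i j : (i < j)%N -> (j < N)%N ->
  d i < d j \/ d i = d j /\ aprec Dp ord (g j) (g i).
Proof.
move=> ij jN; case: Hchain => _ _ sc.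
have := sorted_ltn_nth invlt_trans (0, 0%:Z) sc.
move=> /(_ i j); rewrite !inE => /(_ (ltn_trans ij jN) jN ij) /orP[h|/andP[/eqP h1 h2]].
  by left.
by right.
Qed.

Lemma chain_le i j : (i < j)%N -> (j < N)%N -> d i <= d j.
Proof. by move=> ij jN; case: (chain_lt ij jN) => [/ltW|[->]]. Qed.

(** At the extreme values 0 and 1 of [d], the affine coroot or its translate has degree 0, which
    fixes the sign of its finite part. *)
Lemma inv_facts b : inInv D Dp lam b ->
  [/\ b.1 \in D, 0 < pairing lam b.1, 0 <= dInv lam b <= 1,
     dInv lam b = 0 -> b.1 \in Dp & dInv lam b = 1 -> b.1 \notin Dp].
Proof.
case: b => a k [/= aD pos neg]; set p := pairing lam a in neg *.
have k0 : 0 <= k%:~R :> R by case: pos => [/ltW|[->]].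
have kp : k%:~R <= p.
  by rewrite leNgt; apply/negP => h; apply: neg; left; rewrite subr_gt0.
have p0 : 0 < p.
  rewrite lt_def (le_trans k0 kp) andbT; apply/eqP => pE; apply: neg.
  have kE : k%:~R = 0 :> R by apply/eqP; rewrite eq_le k0 -pE kp.
  right; rewrite kE pE subrr; split=> //.
  by case: pos => [|[]//]; rewrite kE ltxx.
have pn : p != 0 by rewrite gt_eqF.
split=> //; rewrite /dInv /= -/p.
- by rewrite divr_ge0 ?(ltW p0) //= ler_pdivrMr // mul1r.
- move/eqP; rewrite mulf_eq0 invr_eq0 (negPf pn) orbF => /eqP kE.
  by case: pos => [|[]//]; rewrite kE ltxx.
move=> E; apply/negP => aP; apply: neg; right; split=> //.
have kE : k%:~R = p by have := divfK pn (k%:~R : R); rewrite E mul1r => <-.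
by rewrite /= kE subrr.
Qed.

Lemma chain_facts j : (j < N)%N ->
  [/\ g j \in D, 0 < pairing lam (g j), 0 <= d j <= 1,
     d j = 0 -> g j \in Dp & d j = 1 -> g j \notin Dp].
Proof.
move=> jN; apply: inv_facts; case: Hchain => h _ _.
by apply/h/mem_nth.
Qed.

Local Notation lab j := (absr Dp (g j)).

Lemma label_pos j : (j < N)%N -> lab j \in Dp.
Proof.
move=> /chain_facts[gD _ _ _ _]; rewrite /absr.
by case: ifP => // /negbT h; apply: pos_opp.
Qed.

(** Label and sign give back the root, and [d] then gives back the degree, because the pairing with
    [lam] is nonzero. *)
Lemma label_inj i j : (i < N)%N -> (j < N)%N -> d i = d j ->
  (g i \in Dp) = (g j \in Dp) -> lab i = lab j -> i = j.
Proof.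
move=> iN jN dE sE lE; have [_ p0 _ _ _] := chain_facts jN.
have gE : g i = g j by move: lE; rewrite /absr sE; case: ifP => // _ /oppr_inj.
case: Hchain => _ uc _; apply/eqP; rewrite -(nth_uniq (0, 0%:Z) iN jN uc).
move: gE dE p0; rewrite /gam /dd /dInv; case: (nth _ _ i) => a k;
  case: (nth _ _ j) => b l /= -> E p0.
have pn : (pairing lam b)^-1 != 0 by rewrite invr_eq0 gt_eqF.
by rewrite (intr_inj (mulIf pn E)).
Qed.

Lemma label_decreasing i j : (i < j)%N -> (j < N)%N -> d i = d j ->
  (g i \in Dp) = (g j \in Dp) -> olt ord (lab j) (lab i).
Proof.
move=> ij jN dE sE; case: (chain_lt ij jN) => [|[_]]; first by rewrite dE ltxx.
by rewrite /aprec /absr sE; case: (g j \in Dp); rewrite /= ?orbF.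
Qed.

Definition endpoint (w : Mat) (A : seq nat) : Mat :=
  foldl (fun u j => u *m refl (lab j)) w A.

Definition chain_path (w : Mat) (A : seq nat) : Prop :=
  [/\ sorted ltn A, {in A, forall j, (j < N)%N} &
      qbg_path Dp w [seq lab j | j <- A] (endpoint w A)].

Lemma admissible_chain_path w A : admissible Dp chain w A -> chain_path w A.
Proof.
case=> sA /allP bA eA; split=> //; elim: A w eA {sA bA} => //= j A IH w eA.
split; first by have := eA 0%N isT; rewrite /uA /= take0.
by apply: IH => a aA; apply: (eA a.+1).
Qed.

Lemma qbg_path_end w A v : qbg_path Dp w [seq lab j | j <- A] v -> v = endpoint w A.
Proof. by elim: A w => [|j A IH] w /=; [move=> -> | case=> _ /IH]. Qed.

Lemma chain_path_segment w A P Q : chain_path w A ->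
  down_closed P A -> down_closed Q A -> {in A, subpred P Q} ->
  qbg_path Dp (endpoint w (filter P A)) [seq lab j | j <- filter (predD Q P) A]
    (endpoint w (filter Q A)).
Proof.
move=> [sA bA pA] dP dQ PQ; move: pA.
rewrite {1}(down_closed_cat sA dQ) map_cat => /qbg_path_cat[x h _].
have xE := qbg_path_end h; move: h; rewrite {1}(filter_between sA dP dQ PQ) map_cat.
by case/qbg_path_cat => y /qbg_path_end -> h; rewrite -xE.
Qed.

Lemma inW_endpoint w A : inW D w -> {in A, forall j, (j < N)%N} -> inW D (endpoint w A).
Proof.
elim: A w => //= j A IH w Ww bA; apply: IH => [|i iA]; last by apply: bA; rewrite inE iA orbT.
by apply: W_reflr => //; apply/pos_sub_root/label_pos/bA/mem_head.
Qed.

(** With [d] and the sign constant, the labels of both segments are subsequences of [rev ord]. Thus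
    [qbg_path_uniq] equates the labels, and [label_inj] the indices. *)
Lemma segment_uniq w A B P Q c s : inW D w -> chain_path w A -> chain_path w B ->
  down_closed P A -> down_closed Q A -> {in A, subpred P Q} ->
  down_closed P B -> down_closed Q B -> {in B, subpred P Q} ->
  endpoint w (filter P A) = endpoint w (filter P B) ->
  endpoint w (filter Q A) = endpoint w (filter Q B) ->
  (forall j, j \in A \/ j \in B -> predD Q P j -> d j = c /\ (g j \in Dp) = s) ->
  filter (predD Q P) A = filter (predD Q P) B.
Proof.
move=> Ww cA cB dPA dQA PQA dPB dQB PQB EP EQ same.
have pA := chain_path_segment cA dPA dQA PQA.
have := chain_path_segment cB dPB dQB PQB; rewrite -EP -EQ => pB.
case: cA cB => sA bA _ [sB bB _]; have [Dp_uniq _] := HDp.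
have uo : uniq ord by case: Hord => /perm_uniq ->.
have sub X : sorted ltn X -> {in X, forall j, (j < N)%N} ->
    (forall j, j \in X -> predD Q P j -> d j = c /\ (g j \in Dp) = s) ->
    subseq [seq lab j | j <- filter (predD Q P) X] (rev ord).
  move=> sX bX sm; apply: decreasing_subseq => //.
    move=> x /mapP[j]; rewrite mem_filter => /andP[_ /bX jN] ->.
    by case: Hord => /perm_mem -> _; apply: label_pos.
  apply: (@homo_sorted_in _ _ (mem (filter (predD Q P) X)) (fun j => lab j) ltn).
  - move=> i j iT jT ij.
    have /andP[Ti iX] : predD Q P i && (i \in X) by rewrite -mem_filter.
    have /andP[Tj jX] : predD Q P j && (j \in X) by rewrite -mem_filter.
    have [di si] := sm i iX Ti; have [dj sj] := sm j jX Tj.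
    by apply: label_decreasing => //; [exact: bX | rewrite di dj | rewrite si sj].
  - exact/allP.
  - exact: (sorted_filter ltn_trans).
have Wu : inW D (endpoint w (filter P A)).
  by apply: inW_endpoint => // j; rewrite mem_filter => /andP[_ /bA].
have Wv : inW D (endpoint w (filter Q A)).
  by apply: inW_endpoint => // j; rewrite mem_filter => /andP[_ /bA].
have E := qbg_path_uniq HD HDp (reflection_order_rev Dp_uniq Hord) Wu Wv
  (sub A sA bA (fun j jA => same j (or_introl jA)))
  (sub B sB bB (fun j jB => same j (or_intror jB))) pA pB.
apply: (irr_sorted_eq ltn_trans ltnn); rewrite ?(sorted_filter ltn_trans) //.
move=> j; apply/idP/idP => jT.
  have := map_f (fun j => lab j) jT; rewrite E => /mapP[i iT lE].
  rewrite (_ : j = i) //; move: jT iT; rewrite !mem_filter => /andP[Tj jA] /andP[Ti iB].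
  have [dj sj] := same j (or_introl jA) Tj; have [di si] := same i (or_intror iB) Ti.
  by apply: label_inj => //; [exact: bA | exact: bB | rewrite dj | rewrite sj].
have := map_f (fun j => lab j) jT; rewrite -E => /mapP[i iT lE].
rewrite (_ : j = i) //; move: jT iT; rewrite !mem_filter => /andP[Tj jB] /andP[Ti iA].
have [dj sj] := same j (or_intror jB) Tj; have [di si] := same i (or_introl iA) Ti.
by apply: label_inj => //; [exact: bB | exact: bA | rewrite dj | rewrite sj].
Qed.

Definition cut (cs : seq R) (a : nat) : R := nth 0 (0 :: rcons cs 1) a.

Definition below (cs : seq R) (a : nat) : pred nat := fun j => d j < cut cs a.

(** Selects the initial segment ending at the vertex of index [nn a] in [Xi]. *)
Definition below_or_neg (cs : seq R) (a : nat) : pred nat :=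
  fun j => below cs a j || below cs a.+1 j && (g j \notin Dp).

Definition inner_values (A : seq nat) : seq R :=
  sort <=%R (undup [seq c <- [seq d j | j <- A] | (0 < c) && (c < 1)]).

(** * Initial segments cut off by the values of [d] *)

Section Values.
Variables (w : Mat) (X : seq nat).
Hypothesis cX : chain_path w X.
Local Notation cs := (inner_values X).

Lemma mem_inner_values x :
  (x \in cs) = [&& x \in [seq d j | j <- X], 0 < x & x < 1].
Proof. by rewrite mem_sort mem_undup mem_filter andbC. Qed.

Lemma cut_lt a b : (a < b)%N -> (b <= (size cs).+1)%N -> cut cs a < cut cs b.
Proof.
move=> ab bt; have srt : sorted <%R (0 :: rcons cs 1).
  have slt : sorted <%R cs by rewrite lt_sorted_uniq_le sort_uniq undup_uniq sort_le_sorted.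
  have in01 x : x \in cs -> 0 < x < 1 by rewrite mem_inner_values => /and3P[_ -> ->].
  rewrite /= path_sortedE; last exact: lt_trans.
  apply/andP; split.
    by apply/allP => x; rewrite mem_rcons inE => /orP[/eqP->|/in01/andP[]//]; apply: ltr01.
  rewrite -[rcons _ _]revK rev_rcons rev_sorted /= path_sortedE;
    last by move=> y x z h /lt_trans; apply.
  by rewrite all_rev rev_sorted slt andbT; apply/allP => x /in01/andP[].
by apply: (sorted_ltn_nth lt_trans 0 srt) => //;
  rewrite inE /= size_rcons ltnS // (leq_trans (ltnW ab)).
Qed.

Lemma cut_last : cut cs (size cs).+1 = 1.
Proof. by rewrite /cut /= nth_rcons ltnn eqxx. Qed.

Lemma cut_gap a j : j \in X -> (a <= size cs)%N -> cut cs a <= d j -> d j < cut cs a.+1 ->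
  d j = cut cs a.
Proof.
move=> jX acs h1 h2; have [_ bX _] := cX.
have [_ _ /andP[d0 d1] _ _] := chain_facts (bX j jX).
have [dj0|dj0] := eqVneq (d j) 0.
  case: a acs h1 h2 => [|a] acs h1 h2; first by rewrite dj0.
  have := @cut_lt 0 a.+1 isT (leqW acs); rewrite {1}/cut /= => h.
  by have := lt_le_trans h h1; rewrite dj0 ltxx.
have dj1 : d j < 1.
  apply: lt_le_trans h2 _; rewrite -cut_last.
  have [->//|ne] := eqVneq a (size cs); apply/ltW/cut_lt => //.
  by rewrite ltnS ltn_neqAle ne.
have : d j \in cs by rewrite mem_inner_values map_f //= lt_def dj0 d0.
move=> /(nthP 0)[k kcs kE]; have dE : d j = cut cs k.+1.
  by rewrite -kE /cut /= nth_rcons kcs.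
have [ak|ka|->//] := ltngtP a k.+1.
  have [E|ne] := eqVneq a.+1 k.+1; first by move: h2; rewrite dE E ltxx.
  have lk : (a.+1 < k.+1)%N by rewrite ltn_neqAle ne.
  by have := lt_trans h2 (cut_lt lk (leqW kcs)); rewrite -dE ltxx.
by have := cut_lt ka (leqW acs); rewrite -dE ltNge h1.
Qed.

Lemma below_closed a : down_closed (below cs a) X.
Proof.
move=> i j iX jX ij; have [_ bX _] := cX.
by apply: le_lt_trans; apply: chain_le => //; apply: bX.
Qed.

(** Ties in [d] are ordered by the reverse of [aprec], so within one level the negative roots come
    first. *)
Lemma below_or_neg_closed a : (a <= size cs)%N -> down_closed (below_or_neg cs a) X.
Proof.
move=> acs i j iX jX ij; rewrite /below_or_neg.
have [bi|nbi] := boolP (below cs a i) => //=.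
have [bj|nbj] := boolP (below cs a j); first by rewrite (below_closed iX jX ij bj) in nbi.
move=> /andP[bj gj]; have bi := below_closed iX jX ij bj; rewrite bi /=.
have [_ bX _] := cX.
have di := cut_gap iX acs; have dj := cut_gap jX acs.
move: nbi nbj; rewrite /below -!leNgt => /di/(_ bi) {}di /dj/(_ bj) {}dj.
case: (chain_lt ij (bX j jX)) => [|[_]]; first by rewrite di dj ltxx.
by rewrite /aprec (negPf gj) /= => /andP[].
Qed.

Lemma XiE : Xi Dp lam chain w X =
  ([seq endpoint w (filter (below cs ((size cs).+2 - i)) X) | i <- iota 1 (size cs).+1],
   [seq endpoint w (filter (below_or_neg cs ((size cs).+1 - i)) X) | i <- iota 1 (size cs)],
   [seq 1 - cut cs ((size cs).+1 - i) | i <- iota 0 (size cs).+2]).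
Proof.
have [sX _ _] := cX.
have cE a : count (fun x => x < cut cs a) [seq d j | j <- X] = count (below cs a) X.
  by rewrite count_map.
rewrite /Xi -/(inner_values X); congr (_, _, _); apply/eq_in_map => i; rewrite mem_iota.
  move=> _; rewrite /uA -/(cut cs _) cE take_count //; exact: below_closed.
move=> /andP[i1 _]; have ics : ((size cs).+1 - i <= size cs)%N.
  by case: i i1 => // k _; rewrite subSS leq_subr.
rewrite /uA -!/(cut cs _) !cE (count_window (fun j => g j) (fun x => x \notin Dp)) //.
- by rewrite take_count //; apply: below_or_neg_closed.
- exact: below_closed.
- exact: below_closed.
by move=> j _ jb; apply: lt_trans jb _; apply: cut_lt.
Qed.

End Values.

(** Each index lies in one of four kinds of blocks: [d] equal to 0, [d] equal to 1, or an inner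
    value of [d] with either sign. The data fix both ends of each block, so [segment_uniq]
    applies. *)
Lemma decode_sub w A B cs : inW D w -> chain_path w A -> chain_path w B ->
  inner_values A = cs -> inner_values B = cs ->
  (forall a, (0 < a <= (size cs).+1)%N ->
     endpoint w (filter (below cs a) A) = endpoint w (filter (below cs a) B)) ->
  (forall a, (0 < a <= size cs)%N ->
     endpoint w (filter (below_or_neg cs a) A) = endpoint w (filter (below_or_neg cs a) B)) ->
  endpoint w A = endpoint w B -> {subset A <= B}.
Proof.
move=> Ww cA cB EA EB eb em ee j jA.
have fin (X : seq nat) i : X = A \/ X = B -> i \in X -> (i < N)%N.
  by case: cA => _ bA _; case: cB => _ bB _ [->|->]; [apply: bA|apply: bB].
have bcl X a : X = A \/ X = B -> down_closed (below cs a) X.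
  by case=> ->; [rewrite -EA; apply: (below_closed cA)|rewrite -EB; apply: (below_closed cB)].
have mcl X a : X = A \/ X = B -> (a <= size cs)%N -> down_closed (below_or_neg cs a) X.
  case=> -> acs.
    by rewrite -EA; apply: (below_or_neg_closed cA); rewrite EA.
  by rewrite -EB; apply: (below_or_neg_closed cB); rewrite EB.
have gap (i a : nat) : i \in A \/ i \in B -> (a <= size cs)%N -> cut cs a <= d i ->
    d i < cut cs a.+1 -> d i = cut cs a.
  by case=> iX; [rewrite -EA; apply: (cut_gap cA iX)|rewrite -EB; apply: (cut_gap cB iX)].
have facts i : i \in A \/ i \in B -> [/\ 0 <= d i, d i <= 1,
    d i = 0 -> g i \in Dp & d i = 1 -> g i \notin Dp].
  move=> h; have iN : (i < N)%N by case: h; apply: fin; [left|right].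
  by have [_ _ /andP[]] := chain_facts iN.
have lt a b : (a < b)%N -> (b <= (size cs).+1)%N -> cut cs a < cut cs b.
  by rewrite -EA; apply: cut_lt.
have [d0 d1 p0 p1] := facts j (or_introl jA).
have seg P Q c s : (forall X, X = A \/ X = B ->
      [/\ down_closed P X, down_closed Q X & {in X, subpred P Q}]) ->
    endpoint w (filter P A) = endpoint w (filter P B) ->
    endpoint w (filter Q A) = endpoint w (filter Q B) ->
    (forall i, i \in A \/ i \in B -> predD Q P i -> d i = c /\ (g i \in Dp) = s) ->
    predD Q P j -> j \in B.
  move=> h EP EQ same Tj; have [h1 h2 h3] := h A (or_introl erefl).
  have [h4 h5 h6] := h B (or_intror erefl).
  have E := segment_uniq Ww cA cB h1 h2 h3 h4 h5 h6 EP EQ same.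
  have : j \in filter (predD Q P) A by rewrite mem_filter Tj.
  by rewrite E mem_filter => /andP[].
have [dj0|dj0] := eqVneq (d j) 0.
  have c01 := lt 0%N 1%N isT isT.
  (* This first block starts at [w] itself. *)
  apply: (seg pred0 (below cs 1) 0 true).
  - by move=> X hX; split=> //; apply: bcl.
  - by rewrite !filter_pred0.
  - exact: eb.
  - move=> i hi /= bi; have [i0 _ q0 _] := facts i hi.
    by have di := gap i 0%N hi isT i0 bi; rewrite di q0.
  - by rewrite /= /below dj0.
have ct : cut cs (size cs).+1 = 1 by rewrite -EA cut_last.
have [dj1|dj1] := eqVneq (d j) 1.
  (* The last block ends at the endpoint of the whole path, which [Xi] does not record; this is
     where equality of [endA] enters. *)
  apply: (seg (below cs (size cs).+1) predT 1 false).
  - by move=> X hX; split=> //; apply: bcl.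
  - by apply: eb; rewrite leqnn.
  - by rewrite !filter_predT.
  - move=> i hi /=; rewrite andbT /below ct -leNgt => i1.
    have [_ i1' _ q1] := facts i hi; have di : d i = 1 by apply/eqP; rewrite eq_le i1 i1'.
    by split=> //; apply/negbTE/q1.
  - by rewrite /= andbT /below ct dj1 ltxx.
have : d j \in cs by rewrite -EA mem_inner_values map_f //= lt_def dj0 d0 lt_def eq_sym dj1.
move=> /(nthP 0)[k kcs kE]; have dE : d j = cut cs k.+1.
  by rewrite -kE /cut /= nth_rcons kcs.
have lk : cut cs k.+1 < cut cs k.+2 by apply: lt.
have [gP|gN] := boolP (g j \in Dp).
  apply: (seg (below_or_neg cs k.+1) (below cs k.+2) (cut cs k.+1) true).
  - move=> X hX; split; [exact: mcl|exact: bcl|].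
    by move=> i _ /orP[h|/andP[]//]; apply: lt_trans h lk.
  - exact: em.
  - exact: eb.
  - move=> i hi /= /andP[]; rewrite /below_or_neg => /norP[nb] + bi.
    rewrite bi /= negbK => ->; split=> //.
    by apply: gap => //; rewrite leNgt.
  - by rewrite /= /below_or_neg /below dE ltxx lk gP.
apply: (seg (below cs k.+1) (below_or_neg cs k.+1) (cut cs k.+1) false).
- move=> X hX; split; [exact: bcl|exact: mcl|].
  by move=> i _ h; apply/orP; left.
- by apply: eb; apply: leqW.
- exact: em.
- move=> i hi /= /andP[nb]; rewrite /below_or_neg (negPf nb) /= => /andP[bi /negbTE ->].
  by split=> //; apply: gap => //; rewrite leNgt.
- by rewrite /= /below_or_neg /below dE ltxx lk gN.
Qed.

End Chain.

Theorem theorem5p7 (R : realFieldType) (n : nat)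
  (D Dp : seq 'cV[R]_n) (lam : 'cV[R]_n) (ord : seq 'cV[R]_n)
  (w : 'M[R]_n) (chain : seq ('cV[R]_n * int)) :
  simple_root_system D ->
  positive_system D Dp ->
  in_weight_lattice D lam ->
  RO lam Dp ord ->
  inW D w ->
  is_lambda_chain D Dp ord lam chain ->
  forall A B : seq nat,
    admissible Dp chain w A -> admissible Dp chain w B ->
    (Xi Dp lam chain w A, endA Dp chain w A) =
    (Xi Dp lam chain w B, endA Dp chain w B) ->
    A = B.
Proof.
move=> HD HDp _ [Hord _] Ww Hc A B /admissible_chain_path cA /admissible_chain_path cB.
have [sA _ _] := cA; have [sB _ _] := cB.
rewrite (XiE Hc cA) (XiE Hc cB) /endA /uA !take_size.
move EA : (inner_values _ _ A) => a; move EB : (inner_values _ _ B) => b.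
move=> E; have E1 := congr1 (fun x => x.1.1.1) E; have E2 := congr1 (fun x => x.1.1.2) E.
have E3 := congr1 (fun x => x.1.2) E; have E4 := congr1 snd E.
cbn [fst snd] in E1, E2, E3, E4.
have sz : size b = size a by move/(congr1 size): E3; rewrite !size_map !size_iota => -[] ->.
rewrite sz in E1 E2 E3; move/eq_in_map: E1 => E1; move/eq_in_map: E2 => E2.
move/eq_in_map: E3 => E3.
(* The entry of index [(size a).+1 - i.+1] in the third component is 1 minus the inner value of
   index [i]. *)
have ab : b = a.
  apply: (@eq_from_nth _ 0) => // i ib; have ia : (i < size a)%N by rewrite -sz.
  have := E3 ((size a).+1 - i.+1)%N; rewrite mem_iota subKn; last exact: leqW.
  rewrite /= add0n ltnS leq_subr => /(_ isT) /(addrI _)/oppr_inj.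
  by rewrite /cut /= !nth_rcons ia ib => ->.
rewrite {}ab in EB E1 E2 sz *.
have eb k : (0 < k <= (size a).+1)%N ->
    endpoint Dp chain w (filter (below lam chain a k) A) =
    endpoint Dp chain w (filter (below lam chain a k) B).
  case/andP=> k0 kt; have := E1 ((size a).+2 - k)%N; rewrite subKn; last exact: leqW.
  by apply; rewrite mem_iota subn_gt0 ltnS kt add1n ltnS leq_subLR -addn1 addnC leq_add2r.
have em k : (0 < k <= size a)%N ->
    endpoint Dp chain w (filter (below_or_neg Dp lam chain a k) A) =
    endpoint Dp chain w (filter (below_or_neg Dp lam chain a k) B).
  case/andP=> k0 kt; have := E2 ((size a).+1 - k)%N; rewrite subKn; last exact: leqW.
  by apply; rewrite mem_iota subn_gt0 ltnS kt add1n ltnS leq_subLR -addn1 addnC leq_add2r.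
have AB := decode_sub HD HDp Hord Hc Ww cA cB EA EB eb em E4.
have BA := decode_sub HD HDp Hord Hc Ww cB cA EB EA
  (fun k h => esym (eb k h)) (fun k h => esym (em k h)) (esym E4).
apply: (irr_sorted_eq ltn_trans ltnn) => // j.
by apply/idP/idP => [/AB|/BA].
Qed.
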